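(* Let $f:\mathrm{Sym}_{++}(n)\to\mathbb R$ be twice continuously differentiable, and let $P^\star\in\mathrm{Sym}_{++}(n)$ be a nondegenerate local minimizer of $f$. Let $H_E(P^\star)$ be the matrix of the Euclidean Hessian of $f$ at $P^\star$, and let $H_1(P^\star)$ be the matrix of the Riemannian Hessian of $f$ at $P^\star$ with respect to the Alpha-Procrustes metric $g^{(1)}$ (that is, $\alpha=1$). Then $$\lambda_{\min}(H_1(P^\star))\ge\lambda_{\min}(H_E(P^\star)),\qquad \lambda_{\max}(H_1(P^\star))\le 2\,\lambda_{\max}(H_E(P^\star)).$$ Moreover, $$\lambda_{\max}(H_1(P^\star))\ge\lambda_{\max}(H_E(P^\star)),\qquad \lambda_{\min}(H_1(P^\star))\le 2\,\lambda_{\min}(H_E(P^\star)).$$ Consequently, $$\tfrac12\,\kappa(H_E(P^\star))\le\kappa(H_1(P^\star))\le 2\,\kappa(H_E(P^\star)).$$ In particular, the conditioning factor induced by the metric $g^{(1)}$ is bounded by an absolute constant, independently of the condition number of $P^\star$.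
   Context: $\mathrm{Sym}(n)$ is the space of real symmetric $n\times n$ matrices with the Frobenius inner product $\langle X,Y\rangle_F=\mathrm{tr}(X^\top Y)$. $\mathrm{Sym}_{++}(n)$ is the manifold of symmetric positive definite matrices, with tangent spaces identified with $\mathrm{Sym}(n)$. Real powers, $\log$ and $\exp$ of matrices are defined by spectral calculus, and $(Df)(A)[E]$ denotes the Fréchet derivative of $f$ at $A$ in direction $E$. Alpha-Procrustes metric: for $P\in\mathrm{Sym}_{++}(n)$, $\alpha\in\mathbb R$ and $Y\in\mathrm{Sym}(n)$, $\mathcal L_{P,\alpha}(Y)$ is the unique $H\in\mathrm{Sym}(n)$ with $$(D\exp)(\log P)\circ(D\log)(P^{2\alpha})[HP^{2\alpha}+P^{2\alpha}H]=Y,$$ and $g^{(\alpha)}_P(X,Y)=4\,\mathrm{tr}\big(\mathcal L_{P,\alpha}(X)\,P^{2\alpha}\,\mathcal L_{P,\alpha}(Y)\big)$ for $X,Y\in\mathrm{Sym}(n)$. Euclidean gradient and Hessian: $\nabla f(P)\in\mathrm{Sym}(n)$ is defined by $\langle\nabla f(P),Y\rangle_F=(Df)(P)[Y]$, and $\nabla^2f(P)[Y]=(D(\nabla f))(P)[Y]$. A local minimizer $P^\star$ is nondegenerate if $\langle Y,\nabla^2 f(P^\star)[Y]\rangle_F>0$ for all nonzero $Y\in\mathrm{Sym}(n)$. The Riemannian gradient $\mathrm{grad}^{(\alpha)}f(P)$ is defined by $g^{(\alpha)}_P(\mathrm{grad}^{(\alpha)}f(P),Y)=(Df)(P)[Y]$,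 and the Riemannian Hessian is $\mathrm{Hess}^{(\alpha)}f(P)[Y]=\nabla^{(\alpha)}_Y\mathrm{grad}^{(\alpha)}f(P)$, where $\nabla^{(\alpha)}$ is the Levi-Civita connection of $g^{(\alpha)}$. Basis: write $P^\star=Q\Lambda Q^\top$ with $Q$ orthogonal and $\Lambda$ diagonal. $\mathcal B_{P^\star}$ is the Frobenius-orthonormal basis of $\mathrm{Sym}(n)$ consisting of $Qe_ie_i^\top Q^\top$ ($1\le i\le n$) and $\frac1{\sqrt2}Q(e_ie_j^\top+e_je_i^\top)Q^\top$ ($1\le i<j\le n$). $H_E(P^\star)$ and $H_\alpha(P^\star)$ are the matrices in the basis $\mathcal B_{P^\star}$ of $\nabla^2f(P^\star)$ and $\mathrm{Hess}^{(\alpha)}f(P^\star)$, respectively. These matrices have real positive eigenvalues; $\lambda_{\min},\lambda_{\max}$ denote the smallest and largest eigenvalue, and $\kappa=\lambda_{\max}/\lambda_{\min}$. *)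

(* Defs.v *)
From HB Require Import structures.
From mathcomp Require Import all_boot all_order all_algebra.
From mathcomp Require Import all_classical all_reals all_analysis.
Set Implicit Arguments.
Unset Strict Implicit.
Unset Printing Implicit Defensive.
Import Order.TTheory GRing.Theory Num.Theory.
Import numFieldNormedType.Exports.
Local Open Scope classical_set_scope.
Local Open Scope ring_scope.

Definition is_sym_mx {R : realType} {n : nat} : {pred 'M[R]_n} :=
  fun X => X^T == X.

Fact is_sym_mx_submod (R : realType) (n : nat) :
  submod_closed (@is_sym_mx R n).
Proof.
split=> [|a u v]; rewrite ?unfold_in /is_sym_mx; first by rewrite trmx0.
by move=> /eqP hu /eqP hv; rewrite linearD linearZ /= hu hv.
Qed.

HB.instance Definition _ (R : realType) (n : nat) :=
  GRing.isSubmodClosed.Build R 'M[R]_n (@is_sym_mx R n)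
    (is_sym_mx_submod R n).

Record sym (R : realType) (n : nat) := Sym {
  mx_of_sym :> 'M[R]_n;
  mx_of_symP : mx_of_sym \in @is_sym_mx R n }.

HB.instance Definition _ (R : realType) (n : nat) :=
  [isSub for @mx_of_sym R n].
HB.instance Definition _ (R : realType) (n : nat) :=
  [Choice of sym R n by <:].
HB.instance Definition _ (R : realType) (n : nat) :=
  [SubChoice_isSubLmodule of sym R n by <:].

(* [sym R n] is normed by the (entrywise sup) norm of ['M_n].  It is
   finite-dimensional, so the topology and the Frechet derivatives are those
   given by the Frobenius norm. *)
Section SymNormed.
Variables (R : realType) (n : nat).

Let sym_norm (X : sym R n) : R := `|mx_of_sym X|.

Fact sym_ler_normD (X Y : sym R n) :
  sym_norm (X + Y) <= sym_norm X + sym_norm Y.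
Proof. exact: ler_normD. Qed.

Fact sym_normrZ (a : R) (X : sym R n) : sym_norm (a *: X) = `|a| * sym_norm X.
Proof. exact: normrZ. Qed.

Fact sym_normr0_eq0 (X : sym R n) : sym_norm X = 0 -> X = 0.
Proof. by move=> /normr0_eq0 h; apply: val_inj. Qed.

HB.instance Definition _ := Lmodule_isNormed.Build R (sym R n)
  sym_ler_normD sym_normrZ sym_normr0_eq0.
End SymNormed.

Section SymConstructions.
Variables (R : realType) (n : nat).

Fact anticomm_subproof (X Y : sym R n) :
  (X : 'M[R]_n) *m Y + (Y : 'M[R]_n) *m X \in @is_sym_mx R n.
Proof.
rewrite unfold_in /is_sym_mx linearD /= !trmx_mul.
by rewrite (eqP (mx_of_symP X)) (eqP (mx_of_symP Y)) addrC.
Qed.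
Definition anticomm (X Y : sym R n) : sym R n := Sym (anticomm_subproof X Y).

Fact congr_sym_subproof (Q : 'M[R]_n) (X : sym R n) :
  Q *m X *m Q^T \in @is_sym_mx R n.
Proof.
by rewrite unfold_in /is_sym_mx !trmx_mul trmxK (eqP (mx_of_symP X)) mulmxA.
Qed.
Definition congr_sym (Q : 'M[R]_n) (X : sym R n) : sym R n :=
  Sym (congr_sym_subproof Q X).

Fact delta_diag_subproof (i : 'I_n) : delta_mx i i \in @is_sym_mx R n.
Proof. by rewrite unfold_in /is_sym_mx trmx_delta. Qed.
Definition delta_diag (i : 'I_n) : sym R n := Sym (delta_diag_subproof i).

Fact delta_offdiag_subproof (i j : 'I_n) :
  delta_mx i j + delta_mx j i \in @is_sym_mx R n.
Proof. by rewrite unfold_in /is_sym_mx linearD /= !trmx_delta addrC. Qed.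
Definition delta_offdiag (i j : 'I_n) : sym R n :=
  Sym (delta_offdiag_subproof i j).

Definition frob (X Y : sym R n) : R := \tr ((X : 'M[R]_n)^T *m Y).

Definition spd : set (sym R n) :=
  [set P | forall x : 'cV[R]_n, x != 0 -> 0 < (x^T *m P *m x) 0 0].

Definition orthogonal_mx (Q : 'M[R]_n) : Prop := Q^T *m Q = 1%:M.

(* For symmetric [A] such a [B] exists and is independent of the chosen
   diagonalization. *)
Definition spectral_fun (phi : R -> R) (A : sym R n) : sym R n :=
  get [set B | exists (Q : 'M[R]_n) (d : 'rV[R]_n),
    [/\ orthogonal_mx Q,
        mx_of_sym A = Q *m diag_mx d *m Q^T
      & mx_of_sym B = Q *m diag_mx (map_mx phi d) *m Q^T]].

Definition sym_exp : sym R n -> sym R n := spectral_fun expR.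
(* Outside [spd] the values are junk, since [ln] is [0] on nonpositive
   numbers; [spd] is open, so Frechet derivatives at its points do not see
   this.  Same remark for [sym_pow]. *)
Definition sym_log : sym R n -> sym R n := spectral_fun (@ln R).
Definition sym_pow (a : R) : sym R n -> sym R n :=
  spectral_fun (fun x => x `^ a).

Definition procrustes_op (alpha : R) (P Y : sym R n) : sym R n :=
  get [set H | 'd sym_exp (sym_log P)
                 ('d sym_log (sym_pow (2 * alpha) P)
                    (anticomm H (sym_pow (2 * alpha) P))) = Y].

Definition procrustes_metric (alpha : R) (P X Y : sym R n) : R :=
  4 * \tr ((procrustes_op alpha P X : 'M[R]_n)
           *m sym_pow (2 * alpha) P *m procrustes_op alpha P Y).

End SymConstructions.

Section Calculus.
Variable R : realType.

(* Continuity of the derivative is required direction by direction, which is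
   continuity in operator norm when [E] is finite-dimensional. *)
Definition C1_on (E F : normedModType R) (U : set E) (h : E -> F) : Prop :=
  forall P, U P ->
    differentiable h P /\ forall v : E, {for P, continuous (fun x => 'd h x v)}.

Definition C2_on (E F : normedModType R) (U : set E) (h : E -> F) : Prop :=
  (forall P, U P -> differentiable h P) /\
  forall v : E, C1_on U (fun x => 'd h x v).

(* Connections on an open subset [U] of [E], whose tangent spaces are all
   identified with [E].  A vector field is a map [E -> E], of which only the
   restriction to [U] matters, and [nabla P v V] is the covariant derivative
   at [P] of the field [V] along the tangent vector [v], so that
   (nabla_X V)(P) = nabla P (X P) V.  Connections act on C^1 fields because
   the gradient of a C^2 function is in general no more regular. *)
Definition affine_connection (E : normedModType R) (U : set E)
    (nabla : E -> E -> (E -> E) -> E) : Prop :=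
  [/\ forall P (a : R) v w V, U P -> C1_on U V ->
        nabla P (a *: v + w) V = a *: nabla P v V + nabla P w V,
      forall P v V W, U P -> C1_on U V -> C1_on U W ->
        nabla P v (fun x => V x + W x) = nabla P v V + nabla P v W
    & forall P v (h : E -> R) V, U P -> C1_on U (h : E -> R^o) -> C1_on U V ->
        nabla P v (fun x => h x *: V x) =
          ('d (h : E -> R^o) P v : R) *: V P + h P *: nabla P v V].

Definition torsion_free (E : normedModType R) (U : set E)
    (nabla : E -> E -> (E -> E) -> E) : Prop :=
  forall P V W, U P -> C1_on U V -> C1_on U W ->
    nabla P (V P) W - nabla P (W P) V = 'd W P (V P) - 'd V P (W P).

Definition metric_compatible (E : normedModType R) (U : set E)
    (g : E -> E -> E -> R) (nabla : E -> E -> (E -> E) -> E) : Prop :=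
  forall P v V W, U P -> C1_on U V -> C1_on U W ->
    'd (fun x => g x (V x) (W x) : R^o) P v =
      g P (nabla P v V) (W P) + g P (V P) (nabla P v W).

Definition levi_civita (E : normedModType R) (U : set E)
    (g : E -> E -> E -> R) (nabla : E -> E -> (E -> E) -> E) : Prop :=
  [/\ affine_connection U nabla, torsion_free U nabla
    & metric_compatible U g nabla].

End Calculus.

Section Hessians.
Variables (R : realType) (n : nat).
Implicit Types (f : sym R n -> R^o) (P Y : sym R n).

Definition egrad f P : sym R n := get [set G | forall Y, frob G Y = 'd f P Y].

Definition ehess f P Y : sym R n := 'd (egrad f) P Y.

Definition rgrad (alpha : R) f P : sym R n :=
  get [set G | forall Y, procrustes_metric alpha P G Y = 'd f P Y].

Definition rhess (alpha : R)
    (nabla : sym R n -> sym R n -> (sym R n -> sym R n) -> sym R n)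
    f P Y : sym R n :=
  nabla P Y (rgrad alpha f).

Definition nondegenerate_local_min f P : Prop :=
  (\forall X \near P, spd X -> f P <= f X) /\
  (forall Y, Y != 0 -> 0 < frob Y (ehess f P Y)).

End Hessians.

Definition pair_idx (n : nat) := {ij : 'I_n * 'I_n | (ij.1 <= ij.2)%N}.

Definition eigen_basis (R : realType) (n : nat) (Q : 'M[R]_n)
    (k : 'I_(#|{: pair_idx n}|)) : sym R n :=
  let i := (val (enum_val k)).1 in
  let j := (val (enum_val k)).2 in
  if i == j then congr_sym Q (delta_diag R i)
  else (Num.sqrt 2)^-1 *: congr_sym Q (delta_offdiag R i j).

(* Column [b] holds the coordinates of [T (B b)]. *)
Definition matrix_in_basis (R : realType) (E : lmodType R) (N : nat)
    (B : 'I_N -> E) (T : E -> E) : 'M[R]_N :=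
  get [set H : 'M[R]_N | forall b, T (B b) = \sum_a H a b *: B a].

(* [eigenvalue] only sees eigenvalues in [R]; the extreme eigenvalues below are
   meant for matrices all of whose eigenvalues are real. *)
Definition lambda_min (R : realType) (N : nat) (A : 'M[R]_N) : R :=
  get [set a | eigenvalue A a /\ forall b, eigenvalue A b -> a <= b].

Definition lambda_max (R : realType) (N : nat) (A : 'M[R]_N) : R :=
  get [set a | eigenvalue A a /\ forall b, eigenvalue A b -> b <= a].

Definition kappa (R : realType) (N : nat) (A : 'M[R]_N) : R :=
  lambda_max A / lambda_min A.

(* Main.v *)
Require Import Defs.
From HB Require Import structures.
From mathcomp Require Import all_boot all_order all_algebra.
From mathcomp Require Import all_classical all_reals all_analysis.
From mathcomp Require Import ring lra.
Set Implicit Arguments.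
Unset Strict Implicit.
Unset Printing Implicit Defensive.
Import Order.TTheory GRing.Theory Num.Theory.
Import numFieldNormedType.Exports.
Local Open Scope classical_set_scope.
Local Open Scope ring_scope.

(** In an eigenbasis of P, with eigenvalues di > 0, everything is entrywise.  The
    derivative of exp at log P after that of log at P^2 multiplies the (i, j) entry
    by 2 / (di + dj) (the logarithmic divided differences cancel), so the
    operator defining the metric multiplies it by (di + dj) / (2 (di^2 + dj^2)),
    and the metric itself is the Frobenius product weighted by
    w_ij = (di + dj)^2 / (2 (di^2 + dj^2)), a number between 1/2 and 1
    (procrustes_metricE, metric_weight_inv_bounds).

    At a critical point the Hessian does not see the connection: metric
    compatibility applied to the gradient field and to a constant field Y gives
    g(Hess X, Y) = <X-derivative of the Euclidean gradient, Y> (rhess_ehess).  As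
    the basis of the statement diagonalizes the weighting, H_1 = D H_E with D
    diagonal and entries 1 / w_ij in [1, 2] (riemannian_hessian_scaling).  Then H_1
    is similar to the symmetric matrix S H_E S with S^2 = D, and Rayleigh
    quotients give all the inequalities, with constant C = 2
    (diagonal_scaling_extreme_eigenvalues, diagonal_scaling_kappa).

    Three analytic facts support this.  The metric is defined through the
    Frechet derivatives of exp and log, which are computed by the Daleckii-Krein
    formula (spectral_fun_diff); its proof compares the eigenbases of A and A + E
    through their overlap matrix.  The gradient must be a C1 field for metric
    compatibility to apply; it is written with anticommutators and solutions of
    Sylvester equations, whose solution depends on the data in a C1 way
    (C1_on_sylvester, rgrad_C1).  And H_E must be symmetric for its eigenvalues to be
    governed by Rayleigh quotients, which is the symmetry of second derivatives
    (second_diff_symmetric).  The spectral theorem over the reals is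
    obtained by maximizing Rayleigh quotients (constrained_eigenvector). *)

(** * Rayleigh quotients and the real spectral theorem *)

Section Rayleigh.
Variable R : realType.

(** A polynomial in t without constant term that never becomes negative has a
    critical point at 0. *)
Lemma linear_coef_eq0 (b c : R) :
  (forall t, 0 <= t * b + t ^+ 2 * c) -> b = 0.
Proof.
move=> h; apply/eqP; apply: contraT => b0.
have b2 : 0 < b ^+ 2 by rewrite exprn_even_gt0.
have c1 : 0 < `|c| + 1 by rewrite ltr_pwDr.
(* at this t the linear term is larger than the quadratic one *)
have := h (- (b / (`|c| + 1))).
have -> : - (b / (`|c| + 1)) * b + (- (b / (`|c| + 1))) ^+ 2 * c
  = (b ^+ 2 / (`|c| + 1)) * (c / (`|c| + 1) - 1) by field; lra.
rewrite pmulr_rge0 ?divr_gt0// subr_ge0 ler_pdivlMr// mul1r => hc.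
by have := ler_norm c; lra.
Qed.

Lemma continuous_sumr (T : topologicalType) n (f : 'I_n -> T -> R) :
  (forall i, continuous (f i)) -> continuous (fun x => \sum_i f i x).
Proof.
by move=> h x; apply: cvg_big => [|i _]; [exact: add_continuous|exact: h].
Qed.

Variable n : nat.
Implicit Types (A : 'M[R]_n) (x y : 'rV[R]_n).

Definition qform A x : R := (x *m A *m x^T) 0 0.

Lemma qform_cont A : continuous (qform A).
Proof.
move=> x; have -> : qform A = (fun x => \sum_i (\sum_j x 0 j * A j i) * x 0 i).
  by apply/funext=> y; rewrite /qform mxE; apply: eq_bigr => i _; rewrite !mxE.
have cc j := @coord_continuous R 1 n 0 j.
apply: continuous_sumr => i y.
apply: (@continuousM _ _ _ (fun y => y 0 i)); last exact: cc.
apply: continuous_sumr => j z.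
by apply: (@continuousM _ _ (fun y : 'rV_n => y 0 j));
  [exact: cc|exact: cst_continuous].
Qed.

Lemma dotE x y : (x *m y^T) 0 0 = \sum_i x 0 i * y 0 i.
Proof. by rewrite mxE; apply: eq_bigr => i _; rewrite mxE. Qed.

Lemma qform1E x : qform 1%:M x = \sum_i x 0 i ^+ 2.
Proof. by rewrite /qform mulmx1 dotE; apply: eq_bigr => i _; rewrite expr2. Qed.

Lemma qform1_ge0 x : 0 <= qform 1%:M x.
Proof. by rewrite qform1E sumr_ge0 // => i _; rewrite sqr_ge0. Qed.

Lemma qform1_gt0 x : x != 0 -> 0 < qform 1%:M x.
Proof.
move=> x0; rewrite lt_def qform1_ge0 andbT; apply: contra x0 => /eqP.
rewrite qform1E => /psumr_eq0P h; apply/eqP/rowP => i; rewrite mxE.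
by apply/eqP; rewrite -sqrf_eq0; apply/eqP/h => // j _; rewrite sqr_ge0.
Qed.

Lemma qformZ A a x : qform A (a *: x) = a ^+ 2 * qform A x.
Proof.
by rewrite /qform linearZ /= -scalemxAr -!scalemxAl scalerA mxE expr2.
Qed.

Lemma mx11_tr (M : 'M[R]_1) : M^T = M.
Proof. by apply/matrixP => i j; rewrite mxE !ord1. Qed.

Lemma qformD A x y : A^T = A ->
  qform A (x + y) = qform A x + 2 * (x *m A *m y^T) 0 0 + qform A y.
Proof.
move=> As; rewrite /qform linearD /= !mulmxDl !mulmxDr.
have E (M N : 'M[R]_1) : (M + N) 0 0 = M 0 0 + N 0 0 by rewrite mxE.
rewrite !E -[y *m A *m x^T]mx11_tr !trmx_mul trmxK As mulmxA.
ring.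
Qed.

(** A maximizer v of the form of A on the unit sphere of the orthogonal complement
    of finitely many eigenvectors is again an eigenvector: first-order optimality
    makes l v - v A orthogonal to that complement, and by symmetry of A this
    vector already lies in it.  With no constraint (k = 0) this is the Rayleigh
    description of the largest eigenvalue; in general it is the inductive step of
    the spectral theorem. *)
Lemma constrained_eigenvector k A (V : 'M[R]_(k, n)) (d : 'rV[R]_k) :
  A^T = A -> V *m V^T = 1%:M -> V *m A = diag_mx d *m V -> (k < n)%N ->
  exists (v : 'rV[R]_n) (l : R), [/\ v *m v^T = 1%:M, v *m V^T = 0, v *m A = l *: v &
    forall x : 'rV[R]_n, x *m V^T = 0 -> qform A x <= l * qform 1%:M x].
Proof.
move=> As VV VA kn.
pose S := [set x : 'rV[R]_n | qform 1%:M x = 1 /\ x *m V^T = 0].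
have normalize x : x != 0 -> x *m V^T = 0 ->
    S ((Num.sqrt (qform 1%:M x))^-1 *: x).
  move=> x0 xV; split; last by rewrite -scalemxAl xV scaler0.
  have q0 := qform1_gt0 x0.
  by rewrite qformZ exprVn sqr_sqrtr ?(ltW q0)// mulVf // gt_eqF.
have [x0 Sx0] : S !=set0.
  have : kermx V^T != 0.
    rewrite -mxrank_eq0 mxrank_ker -lt0n subn_gt0.
    by rewrite (leq_ltn_trans _ kn) // mxrank_tr rank_leq_row.
  case/rowV0Pn => x /sub_kermxP xV x0.
  by eexists; apply: normalize x0 xV.
have Sc : compact S.
  apply: bounded_closed_compact.
    exists 1; split; rewrite ?num_real // => M M1 x [x1 _].
    rewrite /= [`|_|]mx_normrE; apply: bigmax_le; first by lra.
    move=> [i j] _ /=; rewrite ord1; apply: le_trans (ltW M1).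
    rewrite -(@ler_pXn2r _ 2) ?nnegrE // expr1n -x1 qform1E.
    rewrite real_normK ?num_real // (bigD1 j) //= lerDl.
    by rewrite sumr_ge0 // => l _; rewrite sqr_ge0.
  have -> : S = (qform 1%:M @^-1` [set 1]) `&`
     \bigcap_(i : 'I_k) ((fun x => \sum_j x 0 j * V i j) @^-1` [set 0]).
    apply/seteqP; split=> x [x1 x2]; split=> //.
      move=> i _ /=; have /rowP/(_ i) := x2; rewrite !mxE => h.
      by rewrite -[RHS]h; apply: eq_bigr => j _; rewrite mxE.
    apply/rowP => i; rewrite !mxE -[RHS](x2 i I).
    by apply: eq_bigr => j _; rewrite mxE.
  apply: closedI.
    by apply: preimage_closed; [move=> x _; exact: qform_cont|exact: closed_eq].
  apply: closed_bigI => i _; apply: preimage_closed; last exact: closed_eq.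
  move=> x _; apply: continuous_sumr => j z.
  by apply: (@continuousM _ _ (fun y : 'rV_n => y 0 j));
    [exact: (@coord_continuous R 1 n 0 j)|exact: cst_continuous].
have cq : {within S, continuous (qform A)}.
  by apply: continuous_subspaceT => x; exact: qform_cont.
have [v] := EVT_max_rV (ex_intro _ _ Sx0) Sc cq.
rewrite inE => -[v1 vV] vmax; pose l := qform A v.
(* homogeneity extends the maximum from the sphere to the whole subspace *)
have ray x : x *m V^T = 0 -> qform A x <= l * qform 1%:M x.
  have [->|xn0] := eqVneq x 0.
    by rewrite /qform !mul0mx mxE mulr0.
  move=> xV; have := vmax _ (mem_set (normalize x xn0 xV)).
  have q0 := qform1_gt0 xn0.
  by rewrite qformZ exprVn sqr_sqrtr ?(ltW q0)// ler_pdivrMl // mulrC.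
exists v, l; split => //.
  by rewrite [LHS]mx11_scalar -[v in v *m _]mulmx1 -/(qform _ _) v1.
(* l |x|^2 - x A x^T is nonnegative on the subspace and vanishes at v, hence
     so does its linear part at v *)
have orth (w : 'rV[R]_n) : w *m V^T = 0 -> ((l *: v - v *m A) *m w^T) 0 0 = 0.
  move=> wV; set b := LHS.
  suff : b * 2 = 0 by move/eqP; rewrite mulf_eq0 pnatr_eq0 orbF => /eqP.
  apply: (@linear_coef_eq0 _ (l * qform 1%:M w - qform A w)) => t.
  have : (v + t *: w) *m V^T = 0 by rewrite mulmxDl vV -scalemxAl wV scaler0 addr0.
  move/ray; rewrite !qformD ?trmx1 // !qformZ v1 -/l mulmx1 linearZ /=.
  rewrite -!scalemxAr !mxE.
  have -> : b = l * (v *m w^T) 0 0 - (v *m A *m w^T) 0 0.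
    by rewrite /b mulmxBl -scalemxAl !mxE.
  rewrite -subr_ge0; congr (_ <= _); rewrite !mxE.
  ring.
pose r := l *: v - v *m A.
have rV : r *m V^T = 0.
  rewrite mulmxBl -scalemxAl vV scaler0 sub0r -mulmxA -[A]As -trmx_mul VA.
  by rewrite trmx_mul mulmxA vV mul0mx oppr0.
apply/esym/eqP; rewrite -subr_eq0 -/r; apply: contraT => /qform1_gt0.
by rewrite /qform mulmx1 orth // ltxx.
Qed.

End Rayleigh.

(** The rows of the successive V are the orthonormal eigenvectors found so far;
    constrained_eigenvector supplies the next one. *)
Lemma real_spectral (R : realType) n (A : 'M[R]_n) : A^T = A ->
  exists (Q : 'M[R]_n) (d : 'rV[R]_n),
    orthogonal_mx Q /\ A = Q *m diag_mx d *m Q^T.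
Proof.
move=> As.
have build k : (k <= n)%N -> exists (V : 'M[R]_(k, n)) (d : 'rV[R]_k),
    V *m V^T = 1%:M /\ V *m A = diag_mx d *m V.
  elim: k => [_|k IH kn].
    by exists 0, 0; split; apply/matrixP => -[].
  have [V [d [VV VA]]] := IH (ltnW kn).
  have [v [l [v1 vV vA _]]] := constrained_eigenvector As VV VA kn.
  pose W := col_mx v V; pose e := row_mx l%:M d.
  have WW : W *m W^T = 1%:M.
    rewrite tr_col_mx mul_col_row v1 vV VV.
    by rewrite -[V *m _]trmxK trmx_mul trmxK vV trmx0 -scalar_mx_block.
  have WA : W *m A = diag_mx e *m W.
    rewrite mul_col_mx vA VA diag_mx_row mul_block_col !mul0mx addr0 add0r.
    congr col_mx; rewrite -[LHS]mul_scalar_mx; congr (_ *m _).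
    by apply/matrixP => i j; rewrite !ord1 !mxE.
  by exists W, e.
have [V [d [VV VA]]] := build n (leqnn n).
have V1 := mulmx1C VV.
exists V^T, d; rewrite /orthogonal_mx trmxK; split => //.
by rewrite -mulmxA -VA mulmxA V1 mul1mx.
Qed.

(** * Extreme eigenvalues under diagonal scaling *)

Section ExtremeEigenvalues.
Variables (R : realType) (N : nat).
Implicit Types (A : 'M[R]_N) (x : 'rV[R]_N).

Lemma eigenvalue_qform A a x : x *m A = a *: x -> qform A x = a * qform 1%:M x.
Proof. by move=> h; rewrite /qform h mulmx1 -scalemxAl mxE. Qed.

Lemma top_eigenvector A : A^T = A -> (0 < N)%N ->
  exists (v : 'rV[R]_N) (l : R), [/\ v != 0, v *m A = l *: v &
    forall x, qform A x <= l * qform 1%:M x].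
Proof.
move=> As N0.
have [||v [l [v1 _ vA h]]] :=
  @constrained_eigenvector R N 0 A 0 0 As _ _ N0; try by apply/matrixP => -[].
exists v, l; split => //; last by move=> x; apply: h; apply/matrixP => ? -[].
apply/eqP => v0; move/matrixP/(_ 0 0): v1; rewrite v0 mul0mx !mxE.
by move/eqP; rewrite eq_sym oner_eq0.
Qed.

Lemma eigenvalue_rayleigh A l : (forall x, qform A x <= l * qform 1%:M x) ->
  forall b, eigenvalue A b -> b <= l.
Proof.
move=> h b /eigenvalueP[v vA v0].
have := h v; rewrite (eigenvalue_qform vA) ler_pM2r // qform1_gt0 //.
Qed.

Lemma lambda_max_spec A : A^T = A -> (0 < N)%N ->
  exists v : 'rV[R]_N, [/\ v != 0, qform A v = lambda_max A * qform 1%:M v &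
    forall x, qform A x <= lambda_max A * qform 1%:M x].
Proof.
move=> As N0; have [v [l [v0 vA h]]] := top_eigenvector As N0.
have ev : eigenvalue A l by apply/eigenvalueP; exists v.
suff -> : lambda_max A = l by exists v; split=> //; exact: eigenvalue_qform.
have [e1 e2] : eigenvalue A (lambda_max A) /\
    forall b, eigenvalue A b -> b <= lambda_max A.
  apply: (@getPex _ [set a | eigenvalue A a /\ forall b, eigenvalue A b -> b <= a]).
  by exists l; split=> //; exact: eigenvalue_rayleigh.
by apply/eqP; rewrite eq_le e2 // (eigenvalue_rayleigh h).
Qed.

Lemma qformN A x : qform (- A) x = - qform A x.
Proof. by rewrite /qform mulmxN mulNmx mxE. Qed.

Lemma eigenvalueN A a : eigenvalue (- A) a = eigenvalue A (- a).
Proof.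
apply/eigenvalueP/eigenvalueP => -[v vA v0]; exists v => //.
  by rewrite scaleNr -vA mulmxN opprK.
by rewrite mulmxN vA scaleNr opprK.
Qed.

Lemma lambda_min_spec A : A^T = A -> (0 < N)%N ->
  exists v : 'rV[R]_N, [/\ v != 0, qform A v = lambda_min A * qform 1%:M v &
    forall x, lambda_min A * qform 1%:M x <= qform A x].
Proof.
move=> As N0.
have NAs : (- A)^T = - A by rewrite linearN /= As.
have [v [l [v0 vA h]]] := top_eigenvector NAs N0.
have ev : eigenvalue A (- l) by rewrite -eigenvalueN; apply/eigenvalueP; exists v.
have lb b : eigenvalue A b -> - l <= b.
  by rewrite -[b]opprK -eigenvalueN lerN2; exact: eigenvalue_rayleigh.
suff -> : lambda_min A = - l.
  exists v; split=> //.
    by have /(congr1 -%R) := eigenvalue_qform vA; rewrite qformN opprK mulNr.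
  by move=> x; have := h x; rewrite qformN mulNr lerNl.
have [e1 e2] : eigenvalue A (lambda_min A) /\
    forall b, eigenvalue A b -> lambda_min A <= b.
  apply: (@getPex _ [set a | eigenvalue A a /\ forall b, eigenvalue A b -> a <= b]).
  by exists (- l).
by apply/eqP; rewrite eq_le e2 // lb.
Qed.

(** With S the square root of the scaling, S^2 A is similar to the symmetric
    matrix S A S, whose form at x is the form of A at x S.  Since the squared
    length of x S lies between one and two times that of x, the Rayleigh
    quotients of the two matrices are comparable within a factor two. *)
Lemma diagonal_scaling_extreme_eigenvalues A (w : 'rV[R]_N) :
  (0 < N)%N -> A^T = A -> (forall x, x != 0 -> 0 < qform A x) ->
  (forall i, 1 <= w 0 i <= 2) ->
  let B := diag_mx w *m A in
  [/\ 0 < lambda_min A, lambda_min A <= lambda_min B,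
      lambda_max B <= 2 * lambda_max A, lambda_max A <= lambda_max B &
      lambda_min B <= 2 * lambda_min A].
Proof.
move=> N0 As Apos w12 B.
pose s : 'rV[R]_N := map_mx Num.sqrt w; pose S := diag_mx s.
pose T := diag_mx (map_mx GRing.inv s).
have w0 i : 0 < w 0 i by case/andP: (w12 i) => + _; apply: lt_le_trans.
have SS : S *m S = diag_mx w.
  rewrite mulmx_diag; congr diag_mx; apply/rowP => i.
  by rewrite !mxE -expr2 sqr_sqrtr // ltW.
have TS : T *m S = 1%:M.
  rewrite mulmx_diag -diag_const_mx; congr diag_mx; apply/rowP => i.
  by rewrite !mxE mulVf // gt_eqF // sqrtr_gt0.
have ST : S *m T = 1%:M by exact: mulmx1C.
pose C := S *m A *m S.
have Cs : C^T = C by rewrite !trmx_mul As tr_diag_mx mulmxA.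
have evBC : eigenvalue B = eigenvalue C.
  apply/funext => a; apply/eigenvalueP/eigenvalueP => -[v vA v0].
    exists (v *m S).
      by rewrite scalemxAl -vA /C /B -SS !mulmxA.
    apply: contra v0 => /eqP/(congr1 (mulmxr T)) /=.
    by rewrite -mulmxA ST mulmx1 mul0mx => ->.
  exists (v *m T).
    rewrite scalemxAl -vA /C /B -SS !mulmxA -(mulmxA v T) TS mulmx1.
    by rewrite -(mulmxA _ S T) ST mulmx1.
  apply: contra v0 => /eqP/(congr1 (mulmxr S)) /=.
  by rewrite -mulmxA TS mulmx1 mul0mx => ->.
have -> : lambda_min B = lambda_min C by rewrite /lambda_min evBC.
have -> : lambda_max B = lambda_max C by rewrite /lambda_max evBC.
have qC x : qform C x = qform A (x *m S).
  by rewrite /qform trmx_mul tr_diag_mx !mulmxA.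
have qS x : qform 1%:M x <= qform 1%:M (x *m S) <= 2 * qform 1%:M x.
  rewrite !qform1E mulr_sumr.
  have E i : (x *m S) 0 i ^+ 2 = w 0 i * x 0 i ^+ 2.
    by rewrite mul_mx_diag !mxE exprMn sqr_sqrtr 1?mulrC // ltW.
  by apply/andP; split; apply: ler_sum => i _; rewrite E;
     have /andP[] := w12 i; have := sqr_ge0 (x 0 i); nra.
have [v1 [v1n v1e minA]] := lambda_min_spec As N0.
have [v2 [v2n v2e maxA]] := lambda_max_spec As N0.
have [u1 [u1n u1e minC]] := lambda_min_spec Cs N0.
have [u2 [u2n u2e maxC]] := lambda_max_spec Cs N0.
have minA0 : 0 < lambda_min A.
  by have := Apos _ v1n; rewrite v1e pmulr_lgt0 // qform1_gt0.
have maxA0 : 0 < lambda_max A.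
  by have := Apos _ v2n; rewrite v2e pmulr_lgt0 // qform1_gt0.
have pull (v : 'rV[R]_N) : v = (v *m T) *m S by rewrite -mulmxA TS mulmx1.
split => //.
- rewrite -(ler_pM2r (qform1_gt0 u1n)) -u1e qC.
  apply: le_trans (minA _); rewrite ler_pM2l //.
  by case/andP: (qS u1).
- rewrite -(ler_pM2r (qform1_gt0 u2n)) -u2e qC.
  have /andP[_ /(ler_wpM2l (ltW maxA0))] := qS u2; have := maxA (u2 *m S).
  lra.
- have x0 := qform1_gt0 v2n; rewrite (pull v2) in x0 v2e.
  have := maxC (v2 *m T); rewrite qC v2e.
  have /andP[] := qS (v2 *m T).
  set p := qform 1%:M (v2 *m T); set q := qform _ _ in x0 *; move=> h1 h2 h3.
  have p0 : 0 < p by lra.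
  by rewrite -(ler_pM2r p0); apply: le_trans h3; rewrite ler_pM2l.
- have x0 := qform1_gt0 v1n; rewrite (pull v1) in x0 v1e.
  have := minC (v1 *m T); rewrite qC v1e.
  have /andP[] := qS (v1 *m T).
  set p := qform 1%:M (v1 *m T); set q := qform _ _ in x0 *; move=> h1 h2 h3.
  have p0 : 0 < p by lra.
  by rewrite -(ler_pM2r p0); apply: le_trans h3 _; nra.
Qed.

Lemma diagonal_scaling_kappa A (w : 'rV[R]_N) :
  (0 < N)%N -> A^T = A -> (forall x, x != 0 -> 0 < qform A x) ->
  (forall i, 1 <= w 0 i <= 2) ->
  let B := diag_mx w *m A in
  [/\ 2^-1 * kappa A <= kappa B, kappa B <= 2 * kappa A & kappa B / kappa A <= 2].
Proof.
move=> N0 As Apos w12 B.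
have [m0 m1 M1 M2 m2] := diagonal_scaling_extreme_eigenvalues N0 As Apos w12.
have M0 : 0 < lambda_max A.
  have [v [v0 ve _]] := lambda_max_spec As N0.
  by have := Apos _ v0; rewrite ve pmulr_lgt0 // qform1_gt0.
have n0 : 0 < lambda_min B by apply: lt_le_trans m1.
have kA : 0 < kappa A by rewrite divr_gt0.
have le2 : kappa B <= 2 * kappa A.
  rewrite /kappa mulrA ler_pdivrMr // mulrAC ler_pdivlMr //.
  by rewrite ler_pM // ltW // (lt_le_trans M0).
split=> //; last by rewrite ler_pdivrMr.
rewrite /kappa ler_pdivlMr // mulrA mulrAC ler_pdivrMr //.
by rewrite -mulrA ler_pdivrMl // mulrCA ler_pM // ltW.
Qed.

End ExtremeEigenvalues.

(** * Schur multipliers in an orthonormal eigenbasis *)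

Section Entries.
Variables (R : realType) (n : nat).
Implicit Types (X Y : sym R n) (Q U V : 'M[R]_n).

Lemma sym_tr X : (X : 'M[R]_n)^T = X.
Proof. exact/eqP/(mx_of_symP X). Qed.

Lemma sym_inj X Y : (X : 'M[R]_n) = Y -> X = Y.
Proof. by move=> h; apply: val_inj. Qed.

Lemma sym0E : (0 : sym R n) = 0 :> 'M[R]_n. Proof. by []. Qed.
Lemma sym_sumE (I : finType) (F : I -> sym R n) :
  (\sum_i F i : sym R n) = \sum_i (F i : 'M[R]_n) :> 'M[R]_n.
Proof. exact: (raddf_sum (val : sym R n -> 'M[R]_n)). Qed.

Lemma sym_entry_le X i j : `|(X : 'M[R]_n) i j| <= `|X|.
Proof.
rewrite [leRHS]/(`|(X : 'M[R]_n)|) [leRHS]mx_normrE.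
exact: (le_bigmax _ (fun ij => `|(X : 'M[R]_n) ij.1 ij.2|) (i, j)).
Qed.

Lemma sym_norm_le X c :
  0 <= c -> (forall i j, `|(X : 'M[R]_n) i j| <= c) -> `|X| <= c.
Proof.
move=> c0 h; rewrite [leLHS]/(`|(X : 'M[R]_n)|) [leLHS]mx_normrE.
by apply: bigmax_le => // -[i j] _; exact: h.
Qed.

Lemma orthogonal_mxC Q : orthogonal_mx Q -> Q *m Q^T = 1%:M.
Proof. exact: mulmx1C. Qed.

Lemma orthogonal_mx_tr Q : orthogonal_mx Q -> orthogonal_mx Q^T.
Proof. by move=> Qo; rewrite /orthogonal_mx trmxK orthogonal_mxC. Qed.

Lemma orthogonal_mxM U V :
  orthogonal_mx U -> orthogonal_mx V -> orthogonal_mx (U *m V).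
Proof.
move=> Uo Vo; rewrite /orthogonal_mx trmx_mul mulmxA -(mulmxA V^T) Uo.
by rewrite mulmx1.
Qed.

Lemma orthogonal_col_norm Q j : orthogonal_mx Q -> \sum_i Q i j ^+ 2 = 1.
Proof.
move=> /matrixP/(_ j j); rewrite !mxE eqxx mulr1n => <-.
by apply: eq_bigr => i _; rewrite !mxE expr2.
Qed.

(** Crude entrywise bounds are enough throughout, because all that matters about
    norms is their behaviour near a point in fixed dimension. *)
Lemma orthogonal_entry_le Q i j : orthogonal_mx Q -> `|Q i j| <= 1.
Proof.
move=> /(orthogonal_col_norm j) h.
rewrite -(@ler_pXn2r _ 2) ?nnegrE // expr1n -h real_normK ?num_real //.
by rewrite (bigD1 i) //= lerDl sumr_ge0 // => k _; rewrite sqr_ge0.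
Qed.

Lemma conj_entry_le U V (M : 'M[R]_n) m i j :
  orthogonal_mx U -> orthogonal_mx V -> (forall k l, `|M k l| <= m) ->
  `|(U *m M *m V) i j| <= n%:R ^+ 2 * m.
Proof.
move=> Uo Vo Mm.
have sum_le (F : 'I_n -> R) c : (forall k, F k <= c) -> \sum_k F k <= n%:R * c.
  move=> h; apply: le_trans (ler_sum _ (fun k _ => h k)) _.
  by rewrite sumr_const card_ord mulr_natl.
rewrite expr2 -mulrA mxE; apply: le_trans (ler_norm_sum _ _ _) (sum_le _ _ _) => k.
rewrite normrM; apply: le_trans (ler_piMr _ (orthogonal_entry_le _ _ Vo)) _ => //.
rewrite mxE; apply: le_trans (ler_norm_sum _ _ _) (sum_le _ _ _) => l.
rewrite normrM; apply: le_trans (ler_piMl _ (orthogonal_entry_le _ _ Uo)) _ => //.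
Qed.

End Entries.

Section SpectralMultiplier.
Variables (R : realType) (n : nat).
Implicit Types (w : 'I_n -> 'I_n -> R) (Q X Y : 'M[R]_n) (a : 'rV[R]_n).

(** In the eigenbasis Q of a positive definite matrix, every operator attached to
    that matrix (anticommutator, derivatives of spectral functions, metric)
    multiplies the (i, j) entry by a number w i j.  Expressing all of them in this
    form turns compositions and inverses into arithmetic on the weights. *)
Definition schur_op Q w X : 'M[R]_n :=
  Q *m (\matrix_(i, j) (w i j * (Q^T *m X *m Q) i j)) *m Q^T.

Lemma conjK Q X : orthogonal_mx Q -> Q^T *m (Q *m X *m Q^T) *m Q = X.
Proof.
by move=> Qo; rewrite !mulmxA Qo mul1mx -mulmxA Qo mulmx1.
Qed.

Lemma conjKV Q X : orthogonal_mx Q -> Q *m (Q^T *m X *m Q) *m Q^T = X.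
Proof. by move=> /orthogonal_mx_tr/(@conjK _ X); rewrite trmxK. Qed.

Lemma eq_schur_op Q w1 w2 X :
  (forall i j, w1 i j = w2 i j) -> schur_op Q w1 X = schur_op Q w2 X.
Proof.
move=> h; congr (_ *m _ *m _); apply/matrixP => i j.
by rewrite [LHS]mxE [RHS]mxE h.
Qed.

Lemma schur_op_comp Q w1 w2 X : orthogonal_mx Q ->
  schur_op Q w1 (schur_op Q w2 X) = schur_op Q (fun i j => w1 i j * w2 i j) X.
Proof.
move=> Qo; rewrite /schur_op conjK //; congr (_ *m _ *m _).
by apply/matrixP => i j; rewrite [LHS]mxE [in LHS]mxE [RHS]mxE mulrA.
Qed.

Lemma schur_op1 Q w X : orthogonal_mx Q -> (forall i j, w i j = 1) ->
  schur_op Q w X = X.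
Proof.
move=> Qo w1; rewrite -[RHS](conjKV _ Qo); congr (_ *m _ *m _).
by apply/matrixP => i j; rewrite [LHS]mxE w1 mul1r.
Qed.

Lemma schur_opK Q w1 w2 X Y : orthogonal_mx Q ->
  (forall i j, w1 i j * w2 i j = 1) -> schur_op Q w2 X = Y -> X = schur_op Q w1 Y.
Proof.
by move=> Qo w12 <-; rewrite schur_op_comp // schur_op1.
Qed.

Lemma schur_op_sym Q w X : (forall i j, w i j = w j i) -> X^T = X ->
  (schur_op Q w X)^T = schur_op Q w X.
Proof.
move=> wC Xs; rewrite /schur_op !trmx_mul trmxK mulmxA; congr (_ *m _ *m _).
apply/matrixP => i j; rewrite [LHS]mxE [LHS]mxE [RHS]mxE wC; congr (_ * _).
by rewrite -[in RHS]Xs -[Q in RHS]trmxK -mulmxA -!trmx_mul [RHS]mxE trmxK.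
Qed.

Lemma schur_op_linear Q w c X Y :
  schur_op Q w (c *: X + Y) = c *: schur_op Q w X + schur_op Q w Y.
Proof.
rewrite /schur_op scalemxAl scalemxAr -mulmxDl -mulmxDr; congr (_ *m _ *m _).
apply/matrixP => i j; rewrite mulmxDr mulmxDl -scalemxAr -scalemxAl.
by rewrite [LHS]mxE !(mxE, mulrDr) mulrCA.
Qed.

Lemma schur_op_scale Q w c X :
  schur_op Q (fun i j => c * w i j) X = c *: schur_op Q w X.
Proof.
rewrite /schur_op scalemxAl scalemxAr; congr (_ *m _ *m _).
by apply/matrixP => i j; rewrite !mxE mulrA.
Qed.

Lemma schur_op_selfadjoint Q w X Y :
  \tr ((schur_op Q w X)^T *m Y) = \tr (X^T *m schur_op Q w Y).
Proof.
have trE (M N : 'M[R]_n) : \tr (M^T *m N) = \sum_i \sum_j M j i * N j i.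
  by apply: eq_bigr => i _; rewrite mxE; apply: eq_bigr => j _; rewrite mxE.
rewrite /schur_op !trmx_mul trmxK.
rewrite -!mulmxA mxtrace_mulC -!mulmxA [in RHS]mulmxA [in RHS]mxtrace_mulC.
rewrite -!mulmxA.
have -> : Q^T *m (X^T *m Q) = (Q^T *m (X *m Q))^T.
  by rewrite !trmx_mul trmxK mulmxA.
set H := Q^T *m (X *m Q); set K := Q^T *m (Y *m Q); clearbody H K.
rewrite [in RHS]mxtrace_mulC !trE; apply: eq_bigr => i _; apply: eq_bigr => j _.
rewrite !mxE; ring.
Qed.

Lemma anticomm_schur Q a X : orthogonal_mx Q ->
  X *m (Q *m diag_mx a *m Q^T) + (Q *m diag_mx a *m Q^T) *m X =
  schur_op Q (fun i j => a 0 i + a 0 j) X.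
Proof.
move=> Qo; rewrite -[LHS](conjKV _ Qo) /schur_op; congr (_ *m _ *m _).
have -> : Q^T *m (X *m (Q *m diag_mx a *m Q^T) + Q *m diag_mx a *m Q^T *m X) *m Q
   = (Q^T *m X *m Q) *m diag_mx a + diag_mx a *m (Q^T *m X *m Q).
  rewrite mulmxDr mulmxDl !mulmxA Qo mul1mx; congr (_ + _).
  by rewrite -mulmxA Qo mulmx1.
apply/matrixP => i j; rewrite mul_mx_diag mul_diag_mx !mxE; ring.
Qed.

Lemma schur_op_entry_le Q w X c m i j : orthogonal_mx Q ->
  (forall i j, `|w i j| <= c) -> (forall i j, `|X i j| <= m) ->
  `|schur_op Q w X i j| <= n%:R ^+ 2 * (c * (n%:R ^+ 2 * m)).
Proof.
move=> Qo wc Xm; apply: conj_entry_le => //; first exact: orthogonal_mx_tr.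
move=> k l; rewrite mxE normrM ler_pM //.
by apply: conj_entry_le => //; exact: orthogonal_mx_tr.
Qed.

End SpectralMultiplier.

Section SchurSym.
Variables (R : realType) (n : nat) (Q : 'M[R]_n) (w : 'I_n -> 'I_n -> R).
Hypothesis wC : forall i j, w i j = w j i.

Fact schur_sym_subproof (X : sym R n) : schur_op Q w X \in @is_sym_mx R n.
Proof.
by rewrite unfold_in /is_sym_mx schur_op_sym //; exact: sym_tr.
Qed.
Definition schur_sym (X : sym R n) : sym R n := Sym (schur_sym_subproof X).

Fact schur_sym_is_linear : linear schur_sym.
Proof. by move=> c X Y; apply: sym_inj; exact: schur_op_linear. Qed.

HB.instance Definition _ := GRing.isLinear.Build R (sym R n) (sym R n) _
  schur_sym schur_sym_is_linear.

Lemma schur_sym_bound : orthogonal_mx Q ->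
  exists2 k, 0 < k & forall X, `|schur_sym X| <= k * `|X|.
Proof.
move=> Qo; pose c := \sum_i \sum_j `|w i j|.
have wc i j : `|w i j| <= c.
  rewrite /c (bigD1 i) //= (bigD1 j) //= -addrA lerDl addr_ge0 // sumr_ge0 // => *.
  by rewrite sumr_ge0.
have c0 : 0 <= c by rewrite sumr_ge0 // => *; rewrite sumr_ge0.
exists (n%:R ^+ 2 * (c * n%:R ^+ 2) + 1).
  by rewrite ltr_pwDr // !mulr_ge0 // exprn_ge0.
move=> X; apply: (@le_trans _ _ (n%:R ^+ 2 * (c * (n%:R ^+ 2 * `|X|)))).
  apply: sym_norm_le => [|i j]; first by rewrite !mulr_ge0 // exprn_ge0.
  by apply: schur_op_entry_le => // *; exact: sym_entry_le.
have := normr_ge0 X; lra.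
Qed.

Lemma schur_sym_continuous : orthogonal_mx Q -> continuous schur_sym.
Proof.
move=> Qo; apply: bounded_linear_continuous.
have [k k0 h] := schur_sym_bound Qo.
apply/linear_boundedP.
near=> M => x; apply: le_trans (h x) _.
rewrite ler_wpM2r //; near: M; exact: nbhs_pinfty_ge.
Unshelve. all: by end_near. Qed.

End SchurSym.

(** * Spectral functions and divided differences *)

Section SpectralFun.
Variables (R : realType) (n : nat).
Implicit Types (A B : sym R n) (Q V : 'M[R]_n) (d m : 'rV[R]_n) (phi : R -> R).

Lemma sym_spectral A : exists Q d,
  orthogonal_mx Q /\ (A : 'M[R]_n) = Q *m diag_mx d *m Q^T.
Proof. exact: real_spectral (sym_tr A). Qed.

(** Two diagonalizations of the same matrix only couple equal eigenvalues. *)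
Lemma spectral_overlap Q d V m : orthogonal_mx Q -> orthogonal_mx V ->
  Q *m diag_mx d *m Q^T = V *m diag_mx m *m V^T ->
  forall i j, d 0 i * (Q^T *m V) i j = (Q^T *m V) i j * m 0 j.
Proof.
move=> Qo Vo e i j.
have : diag_mx d *m (Q^T *m V) = Q^T *m V *m diag_mx m.
  have := congr1 (fun M => Q^T *m M *m V) e.
  rewrite !mulmxA Qo mul1mx => ->.
  by rewrite -!mulmxA Vo mulmx1.
by move=> /matrixP/(_ i j); rewrite mul_diag_mx mul_mx_diag [LHS]mxE [RHS]mxE.
Qed.

(** This is the independence of the chosen diagonalization which makes spectral
    functions well defined: the overlap Q^T V vanishes unless the eigenvalues
    agree, and then so do their images under phi. *)
Lemma spectral_map_unique phi Q d V m : orthogonal_mx Q -> orthogonal_mx V ->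
  Q *m diag_mx d *m Q^T = V *m diag_mx m *m V^T ->
  Q *m diag_mx (map_mx phi d) *m Q^T = V *m diag_mx (map_mx phi m) *m V^T.
Proof.
move=> Qo Vo e; have ov := spectral_overlap Qo Vo e.
have h : diag_mx (map_mx phi d) *m (Q^T *m V) =
    (Q^T *m V) *m diag_mx (map_mx phi m).
  apply/matrixP => i j; rewrite mul_diag_mx mul_mx_diag [LHS]mxE [RHS]mxE !mxE.
  have := ov i j; rewrite !mxE; set c := \sum_k _.
  have [->|c0] := eqVneq c 0; first by rewrite !mulr0 !mul0r.
  by rewrite [LHS]mulrC => /(mulfI c0) ->; rewrite mulrC.
have := congr1 (fun M => Q *m M *m V^T) h.
rewrite -!mulmxA (orthogonal_mxC Vo) mulmx1 => ->.
by rewrite (mulmxA Q) (orthogonal_mxC Qo) mul1mx.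
Qed.

Lemma spectral_funE phi A Q d : orthogonal_mx Q ->
  (A : 'M[R]_n) = Q *m diag_mx d *m Q^T ->
  (spectral_fun phi A : 'M[R]_n) = Q *m diag_mx (map_mx phi d) *m Q^T.
Proof.
move=> Qo AE; set S := [set B : sym R n | exists (Q : 'M[R]_n) (d : 'rV[R]_n),
    [/\ orthogonal_mx Q, mx_of_sym A = Q *m diag_mx d *m Q^T
      & mx_of_sym B = Q *m diag_mx (map_mx phi d) *m Q^T]].
have : S (spectral_fun phi A).
  apply: (@getPex _ S).
  have Bs : Q *m diag_mx (map_mx phi d) *m Q^T \in @is_sym_mx R n.
    by rewrite unfold_in /is_sym_mx !trmx_mul trmxK tr_diag_mx mulmxA.
  by exists (Sym Bs), Q, d.
move=> [V [m [Vo AE' ->]]]; apply: spectral_map_unique => //.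
by rewrite -AE -AE'.
Qed.

Definition divided_difference phi dphi (x y : R) : R :=
  if y == x then dphi x else (phi y - phi x) / (y - x).

Lemma divided_differenceE phi dphi x y :
  divided_difference phi dphi x y * (y - x) = phi y - phi x.
Proof.
rewrite /divided_difference; case: eqVneq => [->|yx]; first by rewrite !subrr mulr0.
by rewrite divfK // subr_eq0.
Qed.

Lemma divided_differenceC phi dphi x y :
  divided_difference phi dphi x y = divided_difference phi dphi y x.
Proof.
rewrite /divided_difference [x == y]eq_sym; case: eqVneq => [->//|yx].
by rewrite -opprB -[y - x]opprB invrN mulrNN.
Qed.

(** Away from the diagonal this is continuity of phi, on the diagonal it is
    differentiability. *)
Lemma divided_difference_continuous (phi dphi : R -> R) (a b : R) :
  is_derive a 1 phi (dphi a) -> is_derive b 1 phi (dphi b) ->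
  {for b, continuous (divided_difference phi dphi a)}.
Proof.
move=> ha hb; have [ba|ba] := eqVneq b a.
  have Ea : divided_difference phi dphi a a = dphi a.
    by rewrite /divided_difference eqxx.
  rewrite ba {hb ba b} /prop_for /continuous_at Ea.
  have [ca da] := ha.
  have : h^-1 *: (phi (h *: 1 + a) - phi a) @[h --> 0^'] --> dphi a.
    by rewrite -da; exact: ca.
  move=> /cvgrPdist_le h; apply/cvgrPdist_le => e e0.
  have := h e e0; rewrite near_withinE => /nbhs_ballP[r r0 hr].
  apply/nbhs_ballP; exists r => // x axr; rewrite /=.
  have [->|xa] := eqVneq x a; first by rewrite Ea subrr normr0 ltW.
  rewrite /divided_difference (negbTE xa).
  have /hr : ball (0 : R) r (x - a).
    by move: axr; rewrite /ball /= sub0r normrN distrC.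
  by rewrite subr_eq0 => /(_ xa); rewrite scaler1 subrK [_ *: _]mulrC.
have cphi : {for b, continuous phi}.
  by apply/differentiable_continuous/derivable1_diffP; case: hb.
have : (phi x - phi a) / (x - a) @[x --> b] --> divided_difference phi dphi a b.
  rewrite /divided_difference (negbTE ba).
  apply: cvgM; first by apply: cvgB; [exact: cphi|exact: cvg_cst].
  by apply: cvgV; [rewrite subr_eq0|apply: cvgB; [exact: cvg_id|exact: cvg_cst]].
apply: cvg_trans; apply: near_eq_cvg.
near=> x; rewrite /divided_difference ifN //; near: x.
exact: open_neq.
Unshelve. all: by end_near. Qed.

End SpectralFun.

(** * Derivative of a spectral function *)

Section FrechetBounds.
Variables (R : realType) (V W : normedModType R).

(** Epsilon form of Frechet differentiability, used to prove it; diff_bound is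
    the form in which it is exploited. *)
Lemma diff_of_bound (f : V -> W) (df : {linear V -> W}) x : continuous df ->
  (forall e, 0 < e -> \forall h \near (0 : V), `|f (h + x) - f x - df h| <= e * `|h|) ->
  differentiable f x /\ 'd f x = df :> (V -> W).
Proof.
move=> cdf h.
have E : f \o shift x = cst (f x) + df +o_ (0 : V) id.
  apply/eqaddoP => e e0; near=> y => /=.
  have -> : (f \o shift x - (cst (f x) + df)) y = f (y + x) - f x - df y.
    by rewrite [LHS]/= opprD addrA.
  near: y; exact: h.
have dE := diff_unique cdf E.
by split=> //; apply/diff_locallyP; rewrite dE.
Unshelve. all: by end_near. Qed.

Lemma diff_bound (f : V -> W) x : differentiable f x -> forall e, 0 < e ->
  \forall h \near (0 : V), `|f (h + x) - f x - 'd f x h| <= e * `|h|.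
Proof.
move=> /diff_locally/eqaddoP h e e0.
have := h e e0; apply: filterS => y /=.
have -> // : (f \o shift x - (cst (f x) + 'd f x)) y = f (y + x) - f x - 'd f x y.
by rewrite [LHS]/= opprD addrA.
Qed.

End FrechetBounds.

Section DaleckiiKrein.
Variables (R : realType) (n : nat).
Implicit Types (A B E : sym R n) (Q V : 'M[R]_n) (d m : 'rV[R]_n).

Let N : R := n%:R.

(** The perturbation is read in mixed bases, rows in the eigenbasis of A and columns
    in that of E + A.  There it becomes the eigenvalue gap times the overlap of
    eigenvectors, with no error term; this exact identity replaces any perturbation
    theory of eigenvectors. *)
Lemma overlap_gap A E Q V d m : orthogonal_mx Q -> orthogonal_mx V ->
  (A : 'M[R]_n) = Q *m diag_mx d *m Q^T ->
  mx_of_sym (E + A) = V *m diag_mx m *m V^T ->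
  forall i j, (Q^T *m E *m V) i j = (m 0 j - d 0 i) * (Q^T *m V) i j.
Proof.
move=> Qo Vo AE BE i j.
have -> : Q^T *m E *m V = (Q^T *m V) *m diag_mx m - diag_mx d *m (Q^T *m V).
  have -> : (E : 'M[R]_n) = mx_of_sym (E + A) - mx_of_sym A.
    by apply/esym; exact: (addrK (A : 'M[R]_n)).
  rewrite BE AE mulmxBr mulmxBl !mulmxA Qo mul1mx; congr (_ - _).
  by rewrite -(mulmxA _ V^T) Vo mulmx1.
by rewrite mul_mx_diag mul_diag_mx !mxE; ring.
Qed.

Lemma overlap_gap_le A E Q V d m : orthogonal_mx Q -> orthogonal_mx V ->
  (A : 'M[R]_n) = Q *m diag_mx d *m Q^T ->
  mx_of_sym (E + A) = V *m diag_mx m *m V^T ->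
  forall i j, `|m 0 j - d 0 i| * `|(Q^T *m V) i j| <= N ^+ 2 * `|E|.
Proof.
move=> Qo Vo AE BE i j; rewrite -normrM -(overlap_gap Qo Vo AE BE).
by apply: conj_entry_le => //;
  [exact: orthogonal_mx_tr|move=> *; exact: sym_entry_le].
Qed.

(** An eigenvalue of E + A far from the whole spectrum of A would have small overlap
    with every eigenvector of A, although the overlaps form a unit vector. *)
Lemma eigenvalue_perturb A E Q V d m c : orthogonal_mx Q -> orthogonal_mx V ->
  (A : 'M[R]_n) = Q *m diag_mx d *m Q^T ->
  mx_of_sym (E + A) = V *m diag_mx m *m V^T ->
  N ^+ 3 * `|E| < c -> forall j, exists i, `|m 0 j - d 0 i| <= c.
Proof.
move=> Qo Vo AE BE Ec j; apply/not_existsP => h.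
have c0 : 0 < c by apply: le_lt_trans Ec; rewrite mulr_ge0 ?exprn_ge0.
have Co : orthogonal_mx (Q^T *m V).
  by apply: orthogonal_mxM => //; exact: orthogonal_mx_tr.
have : c * 1 <= N * (N ^+ 2 * `|E|); last first.
  by rewrite mulr1 mulrA -exprS leNgt Ec.
rewrite -(orthogonal_col_norm j Co) mulr_sumr.
have le1 i : c * (Q^T *m V) i j ^+ 2 <= N ^+ 2 * `|E|.
  apply: le_trans (overlap_gap_le Qo Vo AE BE i j).
  have /negP := h i; rewrite -ltNge => /ltW hi.
  rewrite -[_ ^+ 2]real_normK ?num_real //.
  apply: ler_pM hi _; [exact: ltW|exact: exprn_ge0|].
  by rewrite expr2 ler_piMr // orthogonal_entry_le.
apply: le_trans (ler_sum _ (fun i _ => le1 i)) _.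
by rewrite sumr_const card_ord -[leLHS]mulr_natl.
Qed.

(** A modulus for psi between a point x close to the spectrum and an arbitrary
    eigenvalue d k.  If x is close to d k itself, continuity gives the e term;
    otherwise x is at a definite distance from d k and the bounded jump of psi is
    absorbed in the linear term. *)
Lemma near_spectrum_bound (psi : 'I_n -> R -> R) d :
  (forall i k, {for d 0 k, continuous (psi i)}) ->
  exists2 K, 0 <= K & forall e, 0 < e -> exists2 c, 0 < c &
    forall i k l x, `|x - d 0 l| <= c ->
      `|psi i x - psi i (d 0 k)| <= e + K * `|x - d 0 k|.
Proof.
move=> cpsi.
(* slope that covers the jump between d l and d k from half their distance on *)
pose F (t : 'I_n * 'I_n * 'I_n) :=
  `|psi t.1.1 (d 0 t.2) - psi t.1.1 (d 0 t.1.2)| * 2 / `|d 0 t.2 - d 0 t.1.2|.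
have F0 t : 0 <= F t by rewrite !mulr_ge0 // invr_ge0.
exists (\sum_t F t) => [|e e0]; first by rewrite sumr_ge0.
have FK t : F t <= \sum_t F t by rewrite (bigD1 t) //= lerDl sumr_ge0.
have [c c0 hc] : exists2 c : R, 0 < c & forall t : 'I_n * 'I_n * 'I_n, forall x,
    `|x - d 0 t.2| <= c ->
      `|psi t.1.1 x - psi t.1.1 (d 0 t.1.2)| <= e + F t * `|x - d 0 t.1.2|.
  suff : \forall c \near (0 : R)^'+, forall t : 'I_n * 'I_n * 'I_n, forall x,
    `|x - d 0 t.2| <= c ->
      `|psi t.1.1 x - psi t.1.1 (d 0 t.1.2)| <= e + F t * `|x - d 0 t.1.2|.
    move=> H; have : \forall c \near (0 : R)^'+, 0 < c by exact: nbhs_right_gt.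
    by move=> /(filterI H)/filter_ex[c [hc c0]]; exists c.
  apply: filter_forall => -[[i k] l] /=; rewrite /F /=.
  set a := d 0 k; set b := d 0 l.
  have /cvgrPdist_le/(_ e e0)/nbhs_ballP[r r0 hr] := cpsi i l.
  have near_b x : `|x - b| < r -> `|psi i x - psi i b| <= e.
    by move=> xr; rewrite distrC; apply: hr; rewrite /ball /= distrC.
  have [ab|ab] := eqVneq b a.
    near=> c => x xc; rewrite ab subrr normr0 mul0r mul0r mul0r addr0 -ab.
    apply/near_b/(le_lt_trans xc); near: c; exact: nbhs_right_lt.
  have g0 : 0 < `|b - a| by rewrite normr_gt0 subr_eq0.
  near=> c => x xc.
  have xr : `|x - b| < r.
    by apply: (le_lt_trans xc); near: c; exact: nbhs_right_lt.
  have xg : `|x - b| <= `|b - a| / 2.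
    by apply: (le_trans xc); near: c; apply: nbhs_right_le; rewrite divr_gt0.
  have xa : `|b - a| / 2 <= `|x - a|.
    have := ler_distD x b a; rewrite [`|b - x|]distrC; lra.
  have tri := ler_distD (psi i b) (psi i x) (psi i a).
  apply: (le_trans tri); apply: lerD; first exact: near_b.
  set D := `|psi i b - psi i a|.
  have DE : D = D * 2 / `|b - a| * (`|b - a| / 2).
    by field; rewrite gt_eqF.
  rewrite [leLHS]DE.
  by apply: ler_wpM2l => //; rewrite divr_ge0 // mulr_ge0 // /D.
exists c => // i k l x xl.
apply: le_trans (hc (i, k, l) x xl) _.
by rewrite lerD2l ler_wpM2r // FK.
Unshelve. all: by end_near. Qed.

Variables (phi dphi : R -> R) (A : sym R n) (Q : 'M[R]_n) (d : 'rV[R]_n).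
Hypotheses (Qo : orthogonal_mx Q) (AE : (A : 'M[R]_n) = Q *m diag_mx d *m Q^T).
Hypothesis phi_derive : forall i, is_derive (d 0 i) 1 phi (dphi (d 0 i)).

Let dd := divided_difference phi dphi.
Let w i j := dd (d 0 i) (d 0 j).

(** The increment of phi equals its divided difference times the eigenvalue gap, so
    by overlap_gap the remainder of the first-order expansion is a sum of products
    of a change of divided difference, an entry of E and an overlap. *)
Lemma spectral_fun_remainder E V m : orthogonal_mx V ->
  mx_of_sym (E + A) = V *m diag_mx m *m V^T ->
  Q^T *m (mx_of_sym (spectral_fun phi (E + A)) - mx_of_sym (spectral_fun phi A) -
     schur_op Q w E) *m V =
  \matrix_(i, j) \sum_k (dd (d 0 i) (m 0 j) - dd (d 0 i) (d 0 k)) *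
     (Q^T *m E *m Q) i k * (Q^T *m V) k j.
Proof.
move=> Vo BE; rewrite (spectral_funE phi Qo AE) (spectral_funE phi (A := E + A) Vo BE).
set C := Q^T *m V; set H := Q^T *m E *m Q.
have GE : Q^T *m E *m V = H *m C.
  by rewrite /H /C -!mulmxA (mulmxA Q) orthogonal_mxC // mul1mx.
rewrite !mulmxBr !mulmxBl.
have -> : Q^T *m (V *m diag_mx (map_mx phi m) *m V^T) *m V =
    C *m diag_mx (map_mx phi m) by rewrite -!mulmxA Vo mulmx1.
have -> : Q^T *m (Q *m diag_mx (map_mx phi d) *m Q^T) *m V =
    diag_mx (map_mx phi d) *m C by rewrite !mulmxA Qo mul1mx -!mulmxA.
have -> : Q^T *m schur_op Q w E *m V = (\matrix_(i, j) (w i j * H i j)) *m C.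
  by rewrite /schur_op !mulmxA Qo mul1mx -mulmxA.
apply/matrixP => i j.
rewrite mul_mx_diag mul_diag_mx !mxE.
have -> : \sum_k (dd (d 0 i) (m 0 j) - dd (d 0 i) (d 0 k)) * H i k * C k j =
   dd (d 0 i) (m 0 j) * (Q^T *m E *m V) i j -
   \sum_k w i k * H i k * C k j.
  rewrite GE [(H *m C) i j]mxE mulr_sumr -sumrB; apply: eq_bigr => k _.
  by rewrite -/(w i k); ring.
rewrite (overlap_gap Qo Vo AE BE) mulrA divided_differenceE -/C.
congr (_ - _); last by apply: eq_bigr => k _; rewrite mxE.
by rewrite [C i j]mxE mulrBl [X in X - _]mulrC.
Qed.

(** The Daleckii-Krein formula.  In the remainder, near_spectrum_bound controls the
    change of divided difference by a small constant plus a multiple of the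
    eigenvalue gap, and overlap_gap_le turns gap times overlap into the size of E:
    each term is o(E), whatever the multiplicities of the eigenvalues. *)
Lemma spectral_fun_diff E :
  ('d (spectral_fun phi) A E : 'M[R]_n) = schur_op Q w E.
Proof.
have wC i j : w i j = w j i by exact: divided_differenceC.
suff -> : 'd (spectral_fun phi) A = schur_sym Q wC :> (sym R n -> sym R n) by [].
have cpsi i k : {for d 0 k, continuous (dd (d 0 i))}.
  exact: divided_difference_continuous.
have [K K0 hK] := near_spectrum_bound cpsi.
pose L : {linear sym R n -> sym R n} := schur_sym Q wC.
have cL : continuous L by exact: schur_sym_continuous.
suff h : forall e, 0 < e -> \forall h \near (0 : sym R n),
    `|spectral_fun phi (h + A) - spectral_fun phi A - L h| <= e * `|h|.
  by have [_ ->] := diff_of_bound cL h.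
move=> e e0.
have N0 : 0 <= N by rewrite ler0n.
pose M := N ^+ 5 + 1.
have M0 : 0 < M by rewrite ltr_pwDr // exprn_ge0.
have eM0 : 0 < e / (2 * M) by rewrite divr_gt0 // mulr_gt0.
have [c c0 hc] := hK _ eM0.
have N30 : 0 < N ^+ 3 + 1 by rewrite ltr_pwDr // exprn_ge0.
have P0 : 0 < 2 * M * N ^+ 2 * K + 1.
  by rewrite ltr_pwDr // !mulr_ge0 ?exprn_ge0 // ltW.
near=> H.
have [V [m [Vo BE]]] := sym_spectral (H + A).
have HH i j : `|(Q^T *m H *m Q) i j| <= N ^+ 2 * `|H|.
  by apply: conj_entry_le => //;
    [exact: orthogonal_mx_tr|move=> *; exact: sym_entry_le].
have Co : orthogonal_mx (Q^T *m V).
  by apply: orthogonal_mxM => //; exact: orthogonal_mx_tr.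
have Hc : N ^+ 3 * `|H| < c.
  apply: (@le_lt_trans _ _ ((N ^+ 3 + 1) * `|H|)).
    by rewrite ler_wpM2r // lerDl.
  by rewrite -ltr_pdivlMl //; near: H; apply: nbhs0_lt; rewrite mulr_gt0 ?invr_gt0.
have He : (2 * M * N ^+ 2 * K + 1) * `|H| <= e.
  by rewrite -ler_pdivlMl //; near: H; apply: nbhs0_le; rewrite mulr_gt0 ?invr_gt0.
have rem := spectral_fun_remainder Vo BE.
set D : sym R n := spectral_fun phi (H + A) - spectral_fun phi A - schur_sym Q wC H.
have {}rem : Q^T *m D *m V = _ := rem.
(* back from the mixed bases of the remainder formula *)
have DE : (D : 'M[R]_n) = Q *m (Q^T *m D *m V) *m V^T.
  rewrite !mulmxA orthogonal_mxC // mul1mx -mulmxA orthogonal_mxC // mulmx1 //.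
have Rle i j : `|(Q^T *m D *m V) i j| <=
    N * (N ^+ 2 * `|H| * (e / (2 * M) + K * (N ^+ 2 * `|H|))).
  rewrite rem mxE; apply: le_trans (ler_norm_sum _ _ _) _.
  have le1 k : `|(dd (d 0 i) (m 0 j) - dd (d 0 i) (d 0 k)) * (Q^T *m H *m Q) i k
      * (Q^T *m V) k j| <= N ^+ 2 * `|H| * (e / (2 * M) + K * (N ^+ 2 * `|H|)).
    have [l hl] := eigenvalue_perturb Qo Vo AE BE Hc j.
    rewrite -mulrA mulrCA normrM ler_pM // normrM.
    apply: le_trans (ler_wpM2r _ (hc i k l _ hl)) _ => //.
    rewrite mulrDl lerD //.
      by rewrite ler_piMr ?orthogonal_entry_le // ltW.
    by rewrite -mulrA ler_wpM2l // (overlap_gap_le Qo Vo AE BE).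
  apply: le_trans (ler_sum _ (fun k _ => le1 k)) _.
  by rewrite sumr_const card_ord -[leLHS]mulr_natl.
have t0 : 0 <= e / (2 * M) + K * (N ^+ 2 * `|H|).
  by apply: addr_ge0; [exact: ltW|rewrite !mulr_ge0 ?exprn_ge0].
have Dle : `|D| <= N ^+ 2 * (N * (N ^+ 2 * `|H| * (e / (2 * M) + K * (N ^+ 2 * `|H|)))).
  apply: sym_norm_le => [|i j].
    by rewrite !mulr_ge0 ?exprn_ge0.
  rewrite DE; apply: conj_entry_le => //; exact: orthogonal_mx_tr.
apply: (le_trans Dle).
have h0 : 0 <= `|H| by [].
have Klin : M * (K * (N ^+ 2 * `|H|)) <= e / 2.
  have := mulr_ge0 (ltW M0) (mulr_ge0 K0 (mulr_ge0 (exprn_ge0 2 N0) h0)); lra.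
have elin : M * (e / (2 * M)) = e / 2 by field; rewrite gt_eqF.
set t := e / (2 * M) + _ in t0 *.
have Mt : M * t <= e by rewrite mulrDr elin; lra.
have -> : N ^+ 2 * (N * (N ^+ 2 * `|H| * t)) = (M * t - t) * `|H|.
  by rewrite /M; ring.
by rewrite ler_wpM2r //; lra.
Unshelve. all: by end_near. Qed.

End DaleckiiKrein.

(** * Local calculus: minima and symmetry of second derivatives *)

Section LocalCalculus.
Variables (R : realType).

Lemma near0_shift (V : normedModType R) (x : V) (P : set V) :
  (\forall y \near x, P y) -> \forall h \near (0 : V), P (h + x).
Proof. by move/nbhs0P; apply: filterS => h; rewrite addrC. Qed.

Lemma continuous_normP (V W : normedModType R) (f : V -> W) x :
  {for x, continuous f} <->
  forall e, 0 < e -> \forall y \near x, `|f x - f y| <= e.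
Proof. by split=> /cvgrPdist_le. Qed.

Lemma near_eq_diff (V W : normedModType R) (f g : V -> W) x :
  (\forall y \near x, f y = g y) -> differentiable g x ->
  differentiable f x /\ 'd f x = 'd g x :> (V -> W).
Proof.
move=> fg dg; apply: diff_of_bound; first exact: diff_continuous.
move=> e e0; have fgx := nbhs_singleton fg.
near=> h; rewrite fgx (near (near0_shift fg) h) //; near: h.
exact: diff_bound.
Unshelve. all: by end_near. Qed.

Variables (V : normedModType R).
Implicit Types (f : V -> R^o) (x v w : V).

Lemma is_derive_line f x v (t : R) : differentiable f (t *: v + x) ->
  is_derive t 1 (fun s : R => f (s *: v + x)) ('d f (t *: v + x) v).
Proof.
move=> df; have E : (fun h : R => h^-1 *:
     (((fun s : R => f (s *: v + x)) \o shift t) (h *: 1) - f (t *: v + x))) =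
   (fun h : R => h^-1 *: ((f \o shift (t *: v + x)) (h *: v) - f (t *: v + x))).
  apply/funext => h /=; congr (_ *: (f _ - _)).
  by rewrite [h *: 1]mulr1 scalerDl addrA.
split; first by rewrite /derivable E; exact: diff_derivable.
by rewrite /derive E -/(derive f _ _) deriveE.
Qed.

(** Fermat on each line through x. *)
Lemma local_min_diff0 f x : differentiable f x ->
  (\forall y \near x, differentiable f y) -> (\forall y \near x, f x <= f y) ->
  forall v, 'd f x v = 0.
Proof.
move=> dfx df fmin v.
have lineE : (0 : R) *: v + x = x by rewrite scale0r add0r.
have cline : t *: v + x @[t --> (0 : R)] --> x.
  rewrite -[X in _ --> X]lineE; apply: cvgD; last exact: cvg_cst.
  by apply: cvgZr_tmp; exact: cvg_id.
have : \forall t \near (0 : R), differentiable f (t *: v + x) /\ f x <= f (t *: v + x).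
  exact: cline _ (filterI df fmin).
move=> /nbhs_ballP[r r0 hr].
have inr t : t \in `]-r, r[ -> differentiable f (t *: v + x) /\ f x <= f (t *: v + x).
  rewrite in_itv /= => tr; apply: hr.
  by rewrite /ball /= sub0r normrN ltr_norml.
have r0' : (0 : R) \in `]-r, r[ by rewrite in_itv /= oppr_lt0 r0.
have min0 : is_derive (0 : R) 1 (fun s : R => f (s *: v + x)) 0.
  apply: (derive1_at_min (a := - r) (b := r)) => //.
  - by rewrite ge0_cp // ltW.
  - by move=> t /inr[dt _]; have [] := is_derive_line dt.
  - by move=> t /inr[_]; rewrite lineE.
have [_ d1] := min0.
have dl : differentiable f ((0 : R) *: v + x) by rewrite lineE.
have [_ d2] := is_derive_line dl.
by rewrite -d1 d2 lineE.
Qed.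

Definition second_difference f x v w (s : R) : R :=
  f (s *: v + (s *: w + x)) - f (s *: v + x) - f (s *: w + x) + f x.

Lemma second_differenceC f x v w s :
  second_difference f x v w s = second_difference f x w v s.
Proof. by rewrite /second_difference addrCA; ring. Qed.

(** The mean value theorem in the direction v expresses the second difference as s
    times the change of the partial derivative along w, and differentiability of
    that partial derivative at x evaluates the change up to o(s). *)
Lemma second_difference_approx f x v w :
  (\forall y \near x, differentiable f y) ->
  differentiable (fun y => 'd f y v : R^o) x ->
  forall e, 0 < e -> \forall s \near (0 : R)^'+,
    `|second_difference f x v w s - s ^+ 2 * 'd (fun y => 'd f y v : R^o) x w|
      <= e * s ^+ 2.
Proof.
move=> df dF e e0; set F := fun y => 'd f y v : R^o.
pose c := 2 * `|v| + `|w| + 1.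
have c0 : 0 < c by rewrite /c; have := normr_ge0 v; have := normr_ge0 w; lra.
have ec0 : 0 < e / c by rewrite divr_gt0.
have H : \forall h \near (0 : V), differentiable f (h + x) /\
    `|F (h + x) - F x - 'd F x h| <= e / c * `|h|.
  exact: filterI (near0_shift df) (diff_bound dF ec0).
have {H}[r r0 hr] := proj1 nbhs_norm0P H.
near=> s.
have s0 : 0 < s by near: s; exact: nbhs_right_gt.
have sr : s * c < r.
  by rewrite -ltr_pdivlMr //; near: s; apply: nbhs_right_lt; rewrite divr_gt0.
have nle t : t \in `[0, s] ->
    `|t *: v + s *: w| <= s * (`|v| + `|w|) /\ `|t *: v| <= s * `|v|.
  rewrite in_itv /= => /andP[t0 ts].
  have tv : `|t *: v| <= s * `|v| by rewrite normrZ ger0_norm // ler_wpM2r.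
  split=> //; rewrite mulrDr; apply: le_trans (ler_normD _ _) _.
  by rewrite lerD // normrZ gtr0_norm.
have in1 t : t \in `[0, s] -> `|t *: v + s *: w| < r.
  move=> /nle[h _]; apply: le_lt_trans h (le_lt_trans _ sr).
  by rewrite ler_pM2l // /c; have := normr_ge0 v; lra.
have in2 t : t \in `[0, s] -> `|t *: v| < r.
  move=> /nle[_ h]; apply: le_lt_trans h (le_lt_trans _ sr).
  by rewrite ler_pM2l // /c; have := normr_ge0 v; have := normr_ge0 w; lra.
pose phi (t : R) : R := f (t *: v + (s *: w + x)) - f (t *: v + x).
pose dphi (t : R) : R := F (t *: v + (s *: w + x)) - F (t *: v + x).
have hphi t : t \in `[0, s] -> is_derive t 1 phi (dphi t).
  move=> ts; apply: is_deriveB; apply: is_derive_line.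
    by rewrite addrA; exact: (proj1 (hr _ (in1 t ts))).
  exact: (proj1 (hr _ (in2 t ts))).
have cphi : {within `[0, s], continuous phi}.
  apply: derivable_within_continuous => t ts.
  by have [] := hphi t ts.
have hphi' t : t \in `]0, s[ -> is_derive t 1 phi (dphi t).
  by move=> ts; apply: hphi; apply: subset_itv_oo_cc.
have [t ts] := MVT s0 hphi' cphi.
rewrite subr0 => E.
have -> : second_difference f x v w s = dphi t * s.
  by rewrite -E /phi !scale0r !add0r /second_difference; ring.
have {}ts : t \in `[0, s] by apply: subset_itv_oo_cc.
have [_ h1] := hr _ (in1 t ts); have [_ h2] := hr _ (in2 t ts).
have [n1 n2] := nle t ts.
(* the contributions along v cancel between the two expansions at x *)
have D : 'd F x (t *: v + s *: w) - 'd F x (t *: v) = s * 'd F x w.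
  by rewrite linearD addrC addKr linearZ.
have -> : dphi t * s - s ^+ 2 * 'd F x w = s *
  ((F (t *: v + s *: w + x) - F x - 'd F x (t *: v + s *: w)) -
   (F (t *: v + x) - F x - 'd F x (t *: v))).
  by rewrite /dphi addrA expr2 -mulrA -D; ring.
rewrite normrM gtr0_norm // expr2 mulrA [e * s]mulrC -mulrA ler_pM2l //.
apply: le_trans (ler_normB _ _) _.
apply: le_trans (lerD h1 h2) _.
rewrite -mulrDr mulrAC ler_pdivrMr // -mulrA ler_pM2l //.
by apply: le_trans (lerD n1 n2) _; rewrite /c; lra.
Unshelve. all: by end_near. Qed.

(** Symmetry of second derivatives: the second difference is symmetric in v and w
    and approximates both mixed derivatives. *)
Lemma second_diff_symmetric f x v w :
  (\forall y \near x, differentiable f y) ->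
  differentiable (fun y => 'd f y v : R^o) x ->
  differentiable (fun y => 'd f y w : R^o) x ->
  'd (fun y => 'd f y v : R^o) x w = 'd (fun y => 'd f y w : R^o) x v.
Proof.
move=> df dv dw; set a := LHS; set b := RHS.
apply/eqP; rewrite -subr_eq0 -normr_le0; apply/ler_addgt0Pl => e e0; rewrite addr0.
have e2 : 0 < e / 2 by rewrite divr_gt0.
have h1 := second_difference_approx w df dv e2.
have h2 := second_difference_approx v df dw e2.
near (0 : R)^'+ => s.
have s0 : 0 < s by near: s; exact: nbhs_right_gt.
have ha : `|second_difference f x v w s - s ^+ 2 * a| <= e / 2 * s ^+ 2.
  by near: s; exact: h1.
have hb : `|second_difference f x w v s - s ^+ 2 * b| <= e / 2 * s ^+ 2.
  by near: s; exact: h2.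
rewrite second_differenceC in hb; set D := second_difference f x v w s in ha hb.
rewrite -(ler_pM2l (exprn_gt0 2 s0)).
rewrite -[s ^+ 2 in leLHS]gtr0_norm ?exprn_gt0 // -normrM.
have -> : s ^+ 2 * (a - b) = (D - s ^+ 2 * b) - (D - s ^+ 2 * a) by ring.
apply: le_trans (ler_normB _ _) _; lra.
Unshelve. all: by end_near. Qed.

End LocalCalculus.

(** * C1 fields, the Frobenius basis and the Euclidean gradient *)

Section C1.
Variables (R : realType) (E : normedModType R).
Implicit Types (U : set E).

(** Reduces the C1 property to an explicit formula for the derivative, so that
    each closure property below only has to name that formula. *)
Lemma C1_on_of_diff (F : normedModType R) U (f : E -> F) (D : E -> E -> F) :
  open U ->
  (forall x, U x -> differentiable f x /\ forall v, 'd f x v = D x v) ->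
  (forall x v, U x -> {for x, continuous (fun y => D y v)}) -> C1_on U f.
Proof.
move=> oU fD cD P UP; have [dP DP] := fD P UP; split=> // v.
rewrite /prop_for /continuous_at DP.
apply: cvg_trans (cD P v UP); apply: near_eq_cvg.
by apply: filterS (open_nbhs_nbhs (conj oU UP)) => y /fD[_ ->].
Qed.

Lemma C1_on_cst (F : normedModType R) U (c : F) : open U -> C1_on U (fun=> c).
Proof.
move=> oU; apply: (C1_on_of_diff oU (D := fun _ _ => 0)) => [x _|x v _].
  by split=> [|v]; [exact: differentiable_cst|rewrite diff_cst].
exact: cst_continuous.
Qed.

Lemma C1_on_id U : open U -> C1_on U (fun x : E => x).
Proof.
move=> oU; apply: (C1_on_of_diff oU (D := fun _ v => v)) => [x _|x v _].
  by have [dx ->] := is_diff_id x.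
exact: cst_continuous.
Qed.

Lemma C1_on_eq (F : normedModType R) U (f g : E -> F) : open U ->
  (forall x, U x -> f x = g x) -> C1_on U g -> C1_on U f.
Proof.
move=> oU fg gC.
apply: (C1_on_of_diff oU (D := fun x v => 'd g x v)) => [x|x v] Ux;
  have [dg cg] := gC x Ux; last exact: cg.
have near_fg : \forall y \near x, f y = g y.
  by apply: filterS (open_nbhs_nbhs (conj oU Ux)) => y; exact: fg.
by have [df e] := near_eq_diff near_fg dg; split=> // v; rewrite e.
Qed.

Lemma C1_on_add (F : normedModType R) U (f g : E -> F) : open U ->
  C1_on U f -> C1_on U g -> C1_on U (fun x => f x + g x).
Proof.
move=> oU fC gC.
apply: (C1_on_of_diff oU (D := fun x v => 'd f x v + 'd g x v)) => [x|x v] Ux;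
  have [df cf] := fC x Ux; have [dg cg] := gC x Ux.
  by split=> [|v]; [exact: differentiableD|rewrite diffD].
exact: cvgD (cf v) (cg v).
Qed.

Lemma C1_on_sum (F : normedModType R) U (I : Type) (r : seq I) (f : I -> E -> F) :
  open U -> (forall i, C1_on U (f i)) -> C1_on U (fun x => \sum_(i <- r) f i x).
Proof.
move=> oU fC; elim: r => [|i r IH].
  have -> : (fun x => \sum_(i <- [::]) f i x) = fun=> 0.
    by apply/funext => x; rewrite big_nil.
  exact: C1_on_cst.
have -> : (fun x => \sum_(j <- i :: r) f j x) =
    (fun x => f i x + \sum_(j <- r) f j x).
  by apply/funext => x; rewrite big_cons.
exact: C1_on_add.
Qed.

Lemma C1_on_scalel (F : normedModType R) U (k : E -> R^o) (c : F) : open U ->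
  C1_on U k -> C1_on U (fun x => k x *: c).
Proof.
move=> oU kC.
apply: (C1_on_of_diff oU (D := fun x v => ('d k x v : R) *: c)) => [x|x v] Ux;
  have [dk ck] := kC x Ux.
  by split=> [|v]; [exact: differentiableZl|rewrite diffZl].
by apply: cvgZr_tmp; exact: ck.
Qed.

End C1.

Section FrobeniusBasis.
Variables (R : realType) (n : nat).
Implicit Types (X Y Z : sym R n) (Q : 'M[R]_n).

Lemma frobE X Y : frob X Y = \sum_i \sum_j (X : 'M[R]_n) i j * (Y : 'M[R]_n) i j.
Proof.
rewrite /frob /mxtrace exchange_big /=; apply: eq_bigr => i _.
by rewrite mxE; apply: eq_bigr => j _; rewrite mxE.
Qed.

Lemma frobC X Y : frob X Y = frob Y X.
Proof. by rewrite !frobE; do 2![apply: eq_bigr => ? _]; rewrite mulrC. Qed.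

Lemma frobDl X Y Z : frob (X + Y) Z = frob X Z + frob Y Z.
Proof. by rewrite /frob [(_ + _)^T]linearD mulmxDl linearD. Qed.

Lemma frobZl a X Y : frob (a *: X) Y = a * frob X Y.
Proof. by rewrite /frob [(_ *: _)^T]linearZ -scalemxAl linearZ. Qed.

Lemma frobZr a X Y : frob X (a *: Y) = a * frob X Y.
Proof. by rewrite frobC frobZl frobC. Qed.

Lemma frob0l X : frob 0 X = 0.
Proof. by rewrite -(scale0r (0 : sym R n)) frobZl mul0r. Qed.

Lemma frob_suml (I : finType) (F : I -> sym R n) Y :
  frob (\sum_i F i) Y = \sum_i frob (F i) Y.
Proof.
by apply: (big_ind2 (fun X r => frob X Y = r)) => [|X r Z s <- <-|//];
  [exact: frob0l|exact: frobDl].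
Qed.

Lemma frob_sumr (I : finType) X (F : I -> sym R n) :
  frob X (\sum_i F i) = \sum_i frob X (F i).
Proof. by rewrite frobC frob_suml; apply: eq_bigr => i _; rewrite frobC. Qed.

Lemma frob_inj X Y : (forall Z, frob X Z = frob Y Z) -> X = Y.
Proof.
move=> h; apply/eqP; rewrite -subr_eq0; apply/eqP; set D := X - Y.
have : frob D D = 0.
  by rewrite /D frobDl -scaleN1r frobZl h mulN1r subrr.
rewrite frobE => /psumr_eq0P D0; apply: sym_inj; apply/matrixP => i j.
have /psumr_eq0P D1 := D0 (fun i _ => sumr_ge0 _ (fun j _ => sqr_ge0 (D i j))) i isT.
have -> : (0 : sym R n) i j = 0 by rewrite sym0E mxE.
apply/eqP; rewrite -sqrf_eq0 expr2; apply/eqP.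
by apply: D1 => // k _; exact: sqr_ge0.
Qed.

Lemma frob_congr Q X Y : frob (congr_sym Q X) Y = frob X (congr_sym Q^T Y).
Proof.
rewrite /frob /= !trmx_mul !trmxK -!mulmxA mxtrace_mulC -!mulmxA.
by [].
Qed.

Definition pair_of (k : 'I_(#|{: pair_idx n}|)) : 'I_n * 'I_n := val (enum_val k).

Definition unit_scale (k : 'I_(#|{: pair_idx n}|)) : R :=
  if (pair_of k).1 == (pair_of k).2 then 1 else (Num.sqrt 2)^-1.

(** The basis vectors for Q = 1; eigen_basis Q is their image under an isometry
    (eigen_basis_congr, frob_congr). *)
Definition unit_sym (k : 'I_(#|{: pair_idx n}|)) : sym R n :=
  if (pair_of k).1 == (pair_of k).2 then delta_diag R (pair_of k).1
  else (Num.sqrt 2)^-1 *: delta_offdiag R (pair_of k).1 (pair_of k).2.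

Lemma eigen_basis_congr Q k : eigen_basis Q k = congr_sym Q (unit_sym k).
Proof.
rewrite /eigen_basis /unit_sym /pair_of; case: ifP => // _.
by apply: sym_inj; rewrite /= -scalemxAr -scalemxAl.
Qed.

Lemma unit_symE k p q : (unit_sym k : 'M[R]_n) p q =
  unit_scale k * (((p, q) == pair_of k) || ((q, p) == pair_of k))%:R.
Proof.
rewrite /unit_sym /unit_scale; case: (pair_of k) => i j /=; case: eqVneq => [<-|ij].
  rewrite mul1r /= mxE !xpair_eqE [X in _ || X]andbC orbb.
  by [].
rewrite !mxE -!natrD !xpair_eqE; congr (_ * _%:R).
have [->|_] := eqVneq p i; first by rewrite (negbTE ij) andbF addn0 orbF.
by rewrite /= add0n andbC.
Qed.

Lemma pair_of_le k : ((pair_of k).1 <= (pair_of k).2)%N.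
Proof. exact: (valP (enum_val k)). Qed.

Lemma pair_of_inj : injective pair_of.
Proof. by move=> k l /val_inj/enum_val_inj. Qed.

Lemma pair_of_surj p q : exists k, (p, q) = pair_of k \/ (q, p) = pair_of k.
Proof.
have [pq|/ltnW qp] := leqP p q.
  by exists (enum_rank (Sub (p, q) pq : pair_idx n)); left; rewrite /pair_of enum_rankK.
by exists (enum_rank (Sub (q, p) qp : pair_idx n)); right; rewrite /pair_of enum_rankK.
Qed.

(** Both pairs are ordered, so they can be mirror images only if they coincide. *)
Lemma pair_of_swap k l p q : pair_of k = (p, q) -> pair_of l = (q, p) -> k = l.
Proof.
move=> kE lE; apply: pair_of_inj; have := pair_of_le k; have := pair_of_le l.
rewrite kE lE /= => h1 h2; congr pair; first by apply/val_inj/eqP; rewrite eqn_leq h1 h2.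
by apply/val_inj/eqP; rewrite eqn_leq h1 h2.
Qed.

Lemma sym_entryC Y i j : (Y : 'M[R]_n) i j = (Y : 'M[R]_n) j i.
Proof. by rewrite -[in LHS](sym_tr Y) mxE. Qed.

Lemma frob_unit_sym k Y :
  frob (unit_sym k) Y = (unit_scale k)^-1 * (Y : 'M[R]_n) (pair_of k).1 (pair_of k).2.
Proof.
rewrite frobC /unit_sym /unit_scale; set i := (pair_of k).1; set j := (pair_of k).2.
have trd (p q : 'I_n) : \tr ((Y : 'M[R]_n)^T *m delta_mx p q) = (Y : 'M[R]_n) p q.
  rewrite /mxtrace (bigD1 q) //= big1 ?addr0 => [|l lq].
    rewrite mxE (bigD1 p) //= big1 ?addr0 => [|l lp]; first by rewrite !mxE !eqxx mulr1.
    by rewrite !mxE (negbTE lp) mulr0.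
  by rewrite mxE big1 // => r _; rewrite !mxE (negbTE lq) andbF mulr0.
case: eqVneq => [<-|ij]; first by rewrite invr1 mul1r /frob trd.
rewrite frobZr /frob mulmxDr linearD /= !trd (sym_entryC Y j i) invrK.
set y := (Y : 'M[R]_n) i j.
have -> : y + y = Num.sqrt 2 ^+ 2 * y by rewrite sqr_sqrtr //; ring.
by rewrite expr2 !mulrA mulVf ?mul1r // sqrtr_eq0 -ltNge.
Qed.

Lemma unit_scale_neq0 k : unit_scale k != 0.
Proof. by rewrite /unit_scale; case: ifP => // _; rewrite invr_eq0 sqrtr_eq0 -ltNge. Qed.

Lemma unit_sym_orthonormal k l : frob (unit_sym k) (unit_sym l) = (k == l)%:R.
Proof.
rewrite frob_unit_sym unit_symE -surjective_pairing (inj_eq pair_of_inj).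
have [->|kl] := eqVneq k l; first by rewrite /= mulr1 mulVf // unit_scale_neq0.
have -> : ((pair_of k).2, (pair_of k).1) == pair_of l = false.
  apply/eqP => e; move/eqP: kl; apply.
  by apply: pair_of_swap (esym e); exact: surjective_pairing.
by rewrite !mulr0.
Qed.

(** Each entry of Y is seen by a single basis vector, the one indexed by the
    ordered version of its position. *)
Lemma unit_sym_expansion Y : Y = \sum_k frob (unit_sym k) Y *: unit_sym k.
Proof.
apply: sym_inj; rewrite sym_sumE; apply/matrixP => p q; rewrite summxE.
have [k0 k0E] := pair_of_surj p q.
rewrite (bigD1 k0) //= big1 ?addr0 => [|k kk0].
  rewrite [RHS]mxE frob_unit_sym unit_symE mulrACA mulVf ?unit_scale_neq0 // mul1r.
  case: k0E => e; rewrite -e /= eqxx ?orbT mulr1 //.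
  by rewrite sym_entryC.
rewrite [LHS]mxE unit_symE; case: eqP => [e|_].
  case: k0E => e'; first by move/eqP: kk0; case; apply: pair_of_inj; rewrite -e -e'.
  by move/eqP: kk0; case; apply: pair_of_swap (esym e) (esym e').
case: eqP => [e|_]; last by rewrite !mulr0.
case: k0E => e'; last by move/eqP: kk0; case; apply: pair_of_inj; rewrite -e -e'.
by move/eqP: kk0; case; apply: pair_of_swap (esym e) (esym e').
Qed.

Lemma eigen_basis_orthonormal Q k l : orthogonal_mx Q ->
  frob (eigen_basis Q k) (eigen_basis Q l) = (k == l)%:R.
Proof.
move=> Qo; rewrite !eigen_basis_congr frob_congr -unit_sym_orthonormal.
congr frob; apply: sym_inj; rewrite /= trmxK; exact: conjK.
Qed.

Lemma eigen_basis_expansion Q Y : orthogonal_mx Q ->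
  Y = \sum_k frob (eigen_basis Q k) Y *: eigen_basis Q k.
Proof.
move=> Qo; have E := unit_sym_expansion (congr_sym Q^T Y).
have -> : Y = congr_sym Q (congr_sym Q^T Y).
  by apply: sym_inj; rewrite /= trmxK conjKV.
rewrite [in LHS]E; apply: sym_inj; rewrite !sym_sumE /= sym_sumE.
rewrite mulmx_sumr mulmx_suml; apply: eq_bigr => k _.
rewrite !eigen_basis_congr frob_congr /= -scalemxAr -scalemxAl; congr (frob _ _ *: _).
by apply: sym_inj; rewrite /= !trmxK conjK.
Qed.

(** A Schur multiplier is diagonal in eigen_basis; this is why the two Hessian
    matrices differ by a diagonal factor. *)
Lemma schur_op_eigen_basis Q (w : 'I_n -> 'I_n -> R) k : orthogonal_mx Q ->
  (forall i j, w i j = w j i) ->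
  schur_op Q w (eigen_basis Q k) =
    w (pair_of k).1 (pair_of k).2 *: (eigen_basis Q k : 'M[R]_n).
Proof.
move=> Qo wC; rewrite eigen_basis_congr /schur_op [mx_of_sym _]/= conjK //.
rewrite scalemxAl scalemxAr; congr (_ *m _ *m _); apply/matrixP => i j.
rewrite mxE [RHS]mxE unit_symE.
case: eqP => [<-//|_]; case: eqP => [<-|_]; first by rewrite wC.
by rewrite !mulr0.
Qed.

Lemma matrix_in_basisE Q (T : sym R n -> sym R n) : orthogonal_mx Q ->
  forall a b, matrix_in_basis (eigen_basis Q) T a b =
    frob (eigen_basis Q a) (T (eigen_basis Q b)).
Proof.
move=> Qo; set B := eigen_basis Q.
have spec : forall b, T (B b) = \sum_a matrix_in_basis B T a b *: B a.
  apply: (@getPex _ [set H : 'M[R]_(#|{: pair_idx n}|) |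
    forall b, T (B b) = \sum_a H a b *: B a]).
  exists (\matrix_(a, b) frob (B a) (T (B b))) => b.
  rewrite [LHS](eigen_basis_expansion _ Qo).
  by apply: eq_bigr => a _; rewrite mxE.
move=> a b; rewrite [in RHS]spec frob_sumr (bigD1 a) //= big1 => [|k ka].
  by rewrite frobZr eigen_basis_orthonormal // eqxx mulr1 addr0.
by rewrite frobZr eigen_basis_orthonormal // eq_sym (negbTE ka) mulr0.
Qed.

(** Riesz representation in coordinates.  The formula holds at every point, since
    a Frechet derivative is linear even where it has no meaning, and it makes
    the gradient a finite combination of directional derivatives. *)
Lemma egradE Q (f : sym R n -> R^o) : orthogonal_mx Q ->
  egrad f = fun x => \sum_k ('d f x (eigen_basis Q k) : R) *: eigen_basis Q k.
Proof.
move=> Qo; apply/funext => x; set G := RHS.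
have GP Y : frob G Y = 'd f x Y.
  rewrite [in RHS](eigen_basis_expansion Y Qo) linear_sum frob_suml.
  by apply: eq_bigr => k _; rewrite linearZ frobZl mulrC.
apply: frob_inj => Z; rewrite GP.
exact: (@getPex _ [set G | forall Y, frob G Y = 'd f x Y] (ex_intro _ G GP)).
Qed.

Lemma frob_egrad (f : sym R n -> R^o) x Y : frob (egrad f x) Y = 'd f x Y.
Proof.
have Io : orthogonal_mx (1%:M : 'M[R]_n) by rewrite /orthogonal_mx trmx1 mulmx1.
rewrite (egradE f Io) [in RHS](eigen_basis_expansion Y Io) linear_sum frob_suml.
by apply: eq_bigr => k _; rewrite linearZ frobZl mulrC.
Qed.

Lemma egrad_C1 (f : sym R n -> R^o) U : open U -> C2_on U f -> C1_on U (egrad f).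
Proof.
move=> oU [_ fC].
have Io : orthogonal_mx (1%:M : 'M[R]_n) by rewrite /orthogonal_mx trmx1 mulmx1.
rewrite (egradE f Io); apply: C1_on_sum => // k.
exact: C1_on_scalel.
Qed.

Lemma frob_ehess (f : sym R n -> R^o) U x Y Z : open U -> C2_on U f -> U x ->
  frob (ehess f x Y) Z = 'd (fun y => 'd f y Z : R^o) x Y.
Proof.
move=> oU fC Ux.
have [df _] := egrad_C1 oU fC Ux.
pose L : sym R n -> R^o := fun X => frob X Z.
have Llin : linear L by move=> a X1 X2; rewrite /L frobDl frobZl.
pose LlM := GRing.isLinear.Build _ _ _ _ _ Llin.
pose LL : {linear sym R n -> R^o} := HB.pack L LlM.
have cLL : continuous LL.
  apply: bounded_linear_continuous; apply/linear_boundedP.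
  near=> M => X; apply: (@le_trans _ _ ((\sum_i \sum_j `|(Z : 'M[R]_n) i j|) * `|X|)).
    rewrite /= /L frobE mulr_suml; apply: le_trans (ler_norm_sum _ _ _) _.
    apply: ler_sum => i _; rewrite mulr_suml; apply: le_trans (ler_norm_sum _ _ _) _.
    by apply: ler_sum => j _; rewrite normrM mulrC ler_wpM2l // sym_entry_le.
  by apply: ler_wpM2r => //; near: M; exact: nbhs_pinfty_ge.
have -> : (fun y => 'd f y Z : R^o) = LL \o egrad f.
  by apply/funext => y; rewrite /= -[LHS]frob_egrad.
have dL : differentiable LL (egrad f x) by exact: linear_differentiable.
rewrite diff_comp //.
exact: (esym (congr1 (@^~ (ehess f x Y)) (diff_lin (egrad f x) cLL))).
Unshelve. all: by end_near. Qed.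

End FrobeniusBasis.

(** * The positive definite cone and the Jordan product *)

Section SpdCone.
Variables (R : realType) (n : nat).
Implicit Types (P X Y Z : sym R n) (Q : 'M[R]_n) (d : 'rV[R]_n).

Lemma spd_eigenvalues P Q d : orthogonal_mx Q ->
  (P : 'M[R]_n) = Q *m diag_mx d *m Q^T ->
  spd P <-> forall i, 0 < d 0 i.
Proof.
move=> Qo PE.
have formE (x : 'cV[R]_n) : (x^T *m P *m x) 0 0 =
    \sum_i d 0 i * (Q^T *m x) i 0 ^+ 2.
  have -> : x^T *m P *m x = (Q^T *m x)^T *m diag_mx d *m (Q^T *m x).
    by rewrite PE trmx_mul trmxK !mulmxA.
  rewrite mxE; apply: eq_bigr => i _; rewrite mul_mx_diag !mxE; ring.
split=> [Pspd i|d0 x x0].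
  have := Pspd (Q *m delta_mx i 0); rewrite formE mulmxA Qo mul1mx.
  rewrite (bigD1 i) //= big1 ?addr0 => [|j ji]; last first.
    by rewrite mxE (negbTE ji) /= expr0n mulr0.
  rewrite mxE !eqxx expr1n mulr1; apply; apply/eqP => e.
  have := congr1 (mulmx Q^T) e; rewrite mulmxA Qo mul1mx mulmx0.
  by move/matrixP/(_ i 0); rewrite !mxE !eqxx => /eqP; rewrite oner_eq0.
rewrite formE lt_def sumr_ge0 ?andbT => [|i _]; last first.
  by rewrite mulr_ge0 ?sqr_ge0 // ltW.
apply: contra x0 => /eqP/psumr_eq0P y0; apply/eqP.
have Qx : Q^T *m x = 0.
  apply/colP => i; rewrite [RHS]mxE; apply/eqP; rewrite -sqrf_eq0.
  have /eqP := y0 (fun i _ => mulr_ge0 (ltW (d0 i)) (sqr_ge0 _)) i isT.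
  by rewrite mulf_eq0 gt_eqF.
by rewrite -[x]mul1mx -(orthogonal_mxC Qo) -mulmxA Qx mulmx0.
Qed.

Lemma spd_spectral P : spd P -> exists Q d, [/\ orthogonal_mx Q,
  (P : 'M[R]_n) = Q *m diag_mx d *m Q^T & forall i, 0 < d 0 i].
Proof.
move=> Pspd; have [Q [d [Qo PE]]] := sym_spectral P.
by exists Q, d; split=> //; apply/(spd_eigenvalues Qo PE).
Qed.

(** The eigenvalues of a small perturbation stay close to positive numbers. *)
Lemma spd_near P : spd P -> \forall X \near P, spd X.
Proof.
move=> /spd_spectral[Q [d [Qo PE d0]]].
(* a positive lower bound of the spectrum *)
have [c c0 cd] : exists2 c : R, 0 < c & forall i, c < d 0 i.
  exists ((\sum_i (d 0 i)^-1 + 1)^-1).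
    by rewrite invr_gt0 ltr_pwDr // sumr_ge0 // => i _; rewrite invr_ge0 ltW.
  move=> i; rewrite -[ltRHS]invrK ltf_pV2 ?posrE ?invr_gt0 //.
    rewrite (bigD1 i) //= -addrA ltrDl ltr_pwDr // sumr_ge0 // => j _.
    by rewrite invr_ge0 ltW.
  by rewrite ltr_pwDr // sumr_ge0 // => j _; rewrite invr_ge0 ltW.
have N0 : 0 < (n%:R ^+ 3 + 1 : R) by rewrite ltr_pwDr // exprn_ge0.
suff : \forall E \near (0 : sym R n), spd (E + P).
  by move=> h; apply/nbhs0P; apply: filterS h => E; rewrite addrC.
near=> E; have [V [m [Vo BE]]] := sym_spectral (E + P).
apply/(spd_eigenvalues Vo BE) => j.
have Ec : n%:R ^+ 3 * `|E| < c.
  apply: (@le_lt_trans _ _ ((n%:R ^+ 3 + 1) * `|E|)).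
    by rewrite ler_wpM2r // lerDl.
  by rewrite -ltr_pdivlMl //; near: E; apply: nbhs0_lt; rewrite mulr_gt0 ?invr_gt0.
have [i] := eigenvalue_perturb Qo Vo PE BE Ec j.
by rewrite ler_norml => /andP[h _]; have := cd i; lra.
Unshelve. all: by end_near. Qed.

Lemma spd_open : open (@spd R n).
Proof. by rewrite openE => P; exact: spd_near. Qed.

End SpdCone.

Section AnticommCalculus.
Variables (R : realType) (n : nat).
Implicit Types (P X Y Z : sym R n) (Q : 'M[R]_n) (d : 'rV[R]_n).

Lemma anticommC X Y : anticomm X Y = anticomm Y X.
Proof. by apply: sym_inj; rewrite /= addrC. Qed.

Lemma anticomm_linear X a Y Z :
  anticomm X (a *: Y + Z) = a *: anticomm X Y + anticomm X Z.
Proof.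
apply: sym_inj; rewrite /= mulmxDr mulmxDl -scalemxAr -scalemxAl scalerDr.
by rewrite addrACA.
Qed.

Lemma anticommDr X Y Z : anticomm X (Y + Z) = anticomm X Y + anticomm X Z.
Proof. by have := anticomm_linear X 1 Y Z; rewrite !scale1r. Qed.

Lemma anticommBr X Y Z : anticomm X (Y - Z) = anticomm X Y - anticomm X Z.
Proof.
by rewrite addrC -scaleN1r anticomm_linear scaleN1r addrC.
Qed.

Lemma anticommBl X Y Z : anticomm (Y - Z) X = anticomm Y X - anticomm Z X.
Proof. by rewrite !(anticommC _ X) anticommBr. Qed.

(** The constant is the crude bound for products in the entrywise sup norm. *)
Lemma anticomm_norm X Y : `|anticomm X Y| <= 2 * n%:R * (`|X| * `|Y|).
Proof.
have mul_le (A B : sym R n) i j :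
    `|((A : 'M[R]_n) *m B) i j| <= n%:R * (`|A| * `|B|).
  rewrite mxE; apply: le_trans (ler_norm_sum _ _ _) _.
  apply: (@le_trans _ _ (\sum_(k < n) `|A| * `|B|)).
    by apply: ler_sum => k _; rewrite normrM ler_pM // sym_entry_le.
  by rewrite sumr_const card_ord -[leLHS]mulr_natl.
apply: sym_norm_le => [|i j]; first by rewrite !mulr_ge0.
rewrite /= mxE; apply: le_trans (ler_normD _ _) _.
apply: le_trans (lerD (mul_le X Y i j) (mul_le Y X i j)) _.
by rewrite [`|Y| * _]mulrC; lra.
Qed.

Fact anticomm_bilinear_subproof :
  bilinear_for (GRing.Scale.Law.clone _ _ *:%R _) (GRing.Scale.Law.clone _ _ *:%R _)
    (@anticomm R n).
Proof.
split=> [Y a X Z|X a Y Z] /=; last exact: anticomm_linear.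
by rewrite !(anticommC _ Y) anticomm_linear.
Qed.

HB.instance Definition _ := bilinear_isBilinear.Build R (sym R n) (sym R n) (sym R n)
  _ _ (@anticomm R n) anticomm_bilinear_subproof.

Lemma anticomm_continuous :
  continuous (fun p : sym R n * sym R n => anticomm p.1 p.2).
Proof.
move=> p; apply/cvgrPdist_le => e e0 /=.
pose K := 2 * n%:R * (`|p.1| + `|p.2| + 1) + 1.
have K0 : 0 < K by rewrite ltr_pwDr // !mulr_ge0 // addr_ge0 // addr_ge0.
have c1 : (fun q : sym R n * sym R n => q.1) @ p --> p.1 by exact: cvg_fst.
have c2 : (fun q : sym R n * sym R n => q.2) @ p --> p.2 by exact: cvg_snd.
move/cvgrPdist_le: c1 => c1; move/cvgrPdist_le: c2 => c2.
have eK : 0 < e / K by rewrite divr_gt0.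
near=> q.
have q1 : `|p.1 - q.1| <= e / K by near: q; exact: c1.
have q2 : `|p.2 - q.2| <= e / K by near: q; exact: c2.
have q3 : `|p.2 - q.2| <= 1 by near: q; exact: c2.
have -> : anticomm p.1 p.2 - anticomm q.1 q.2 =
    anticomm (p.1 - q.1) q.2 + anticomm p.1 (p.2 - q.2).
  by rewrite anticommBl anticommBr [RHS]addrC addrA subrK.
apply: le_trans (ler_normD _ _) _.
apply: le_trans (lerD (anticomm_norm _ _) (anticomm_norm _ _)) _.
have q2n : `|q.2| <= `|p.2| + 1.
  have -> : q.2 = p.2 - (p.2 - q.2) by rewrite opprB addrC subrK.
  by apply: le_trans (ler_normB _ _) _; rewrite lerD2l.
rewrite -mulrDr.
apply: (@le_trans _ _ (2 * n%:R * (e / K * (`|p.2| + 1) + `|p.1| * (e / K)))).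
  by rewrite ler_wpM2l ?mulr_ge0 // lerD // ler_pM.
have -> : 2 * n%:R * (e / K * (`|p.2| + 1) + `|p.1| * (e / K)) = (K - 1) * (e / K).
  by rewrite /K; ring.
have KE : K * (e / K) = e by rewrite mulrC divfK // gt_eqF.
by rewrite mulrBl KE mul1r lerBlDr lerDl ltW.
Unshelve. all: by end_near. Qed.

Lemma anticomm_cvg (T : Type) (F : set_system T) {FF : Filter F}
    (f g : T -> sym R n) a b :
  f @ F --> a -> g @ F --> b ->
  (fun x => anticomm (f x) (g x)) @ F --> anticomm a b.
Proof.
move=> fa gb; refine (continuous2_cvg FF _ fa gb).
exact: (@anticomm_continuous (a, b)).
Qed.

Lemma anticomm_diff (f g : sym R n -> sym R n) x :
  differentiable f x -> differentiable g x ->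
  differentiable (fun y => anticomm (f y) (g y)) x /\
  'd (fun y => anticomm (f y) (g y)) x =
    (fun v => anticomm (f x) ('d g x v) + anticomm ('d f x v) (g x)) :> (_ -> _).
Proof.
move=> df dg.
pose B : {bilinear sym R n -> sym R n -> sym R n} := @anticomm R n.
have dB p : differentiable (fun p => B p.1 p.2) p.
  by apply: differentiable_bilin; exact: anticomm_continuous.
have E : (fun y => anticomm (f y) (g y)) = (fun p => B p.1 p.2) \o (fun y => (f y, g y)).
  by [].
have dfg := differentiable_pair df dg.
rewrite E; split; first exact: differentiable_comp.
have H1 := diff_comp dfg (dB (f x, g x)).
have H2 := diff_pair df dg.
have H3 := diff_bilin (f x, g x) (anticomm_continuous : continuous (fun p => B p.1 p.2)).
refine (etrans H1 _); apply: funext => v.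
refine (etrans _ (congr1 (@^~ ('d f x v, 'd g x v)) H3)).
exact: (congr1 (fun h => 'd (fun p => B p.1 p.2) (f x, g x) (h v)) H2).
Qed.

Lemma C1_on_anticomm (U : set (sym R n)) (f g : sym R n -> sym R n) : open U ->
  C1_on U f -> C1_on U g -> C1_on U (fun x => anticomm (f x) (g x)).
Proof.
move=> oU fC gC.
pose D x v := anticomm (f x) ('d g x v) + anticomm ('d f x v) (g x).
apply: (C1_on_of_diff oU (D := D)) => [x|x v] Ux;
  have [df cdf] := fC x Ux; have [dg cdg] := gC x Ux.
  have [dfg e] := anticomm_diff df dg.
  by split=> // v; exact: (congr1 (@^~ v) e).
have cf : f y @[y --> x] --> f x by exact: differentiable_continuous.
have cg : g y @[y --> x] --> g x by exact: differentiable_continuous.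
have cdfv : 'd f y v @[y --> x] --> 'd f x v := cdf v.
have cdgv : 'd g y v @[y --> x] --> 'd g x v := cdg v.
exact: cvgD (anticomm_cvg cf cdgv) (anticomm_cvg cdfv cg).
Qed.

End AnticommCalculus.

(** * The Sylvester equation *)

Section SylvesterSolution.
Variables (R : realType) (n : nat).
Implicit Types (P X Y Z : sym R n) (Q : 'M[R]_n) (d : 'rV[R]_n).

(** The Riemannian gradient involves the inverse of the anticommutator with x, and
    it has to be differentiated in x.  The lemmas below obtain continuity and
    differentiability of the solution by perturbing the equation itself, so no
    formula for the inverse operator is differentiated. *)
Definition sylvester P Z : sym R n := get [set V | anticomm P V = Z].

Lemma anticommE P Q d X : orthogonal_mx Q ->
  (P : 'M[R]_n) = Q *m diag_mx d *m Q^T ->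
  (anticomm P X : 'M[R]_n) = schur_op Q (fun i j => d 0 i + d 0 j) X.
Proof. by move=> Qo PE; rewrite /= addrC PE anticomm_schur. Qed.

Lemma sylvester_unique P Q d : orthogonal_mx Q ->
  (P : 'M[R]_n) = Q *m diag_mx d *m Q^T -> (forall i, 0 < d 0 i) ->
  forall V Z, anticomm P V = Z ->
    (V : 'M[R]_n) = schur_op Q (fun i j => (d 0 i + d 0 j)^-1) Z.
Proof.
move=> Qo PE d0 V Z VZ.
apply: schur_opK Qo _ (etrans (esym (anticommE V Qo PE)) (congr1 _ VZ)) => i j.
by rewrite mulVf // gt_eqF // addr_gt0.
Qed.

Lemma sylvesterP P Z : spd P -> anticomm P (sylvester P Z) = Z.
Proof.
move=> /spd_spectral[Q [d [Qo PE d0]]].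
apply: (@getPex _ [set V | anticomm P V = Z]).
have wC (i j : 'I_n) : (d 0 i + d 0 j)^-1 = (d 0 j + d 0 i)^-1 by rewrite addrC.
exists (schur_sym Q wC Z); apply: sym_inj; rewrite (anticommE _ Qo PE) /=.
rewrite schur_op_comp // schur_op1 // => i j.
by rewrite mulfV // gt_eqF // addr_gt0.
Qed.

Lemma sylvesterE P Q d Z : spd P -> orthogonal_mx Q ->
  (P : 'M[R]_n) = Q *m diag_mx d *m Q^T ->
  (sylvester P Z : 'M[R]_n) = schur_op Q (fun i j => (d 0 i + d 0 j)^-1) Z.
Proof.
move=> Pspd Qo PE; have d0 := (proj1 (spd_eigenvalues Qo PE) Pspd).
exact: sylvester_unique (sylvesterP Z Pspd).
Qed.

Lemma sylvesterK P V Z : spd P -> anticomm P V = Z -> V = sylvester P Z.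
Proof.
move=> Pspd VZ; have [Q [d [Qo PE d0]]] := spd_spectral Pspd.
by apply: sym_inj; rewrite (sylvesterE Z Pspd Qo PE); exact: sylvester_unique VZ.
Qed.

Lemma sylvester_linear P : spd P -> linear (sylvester P).
Proof.
move=> Pspd a X Y; apply/esym/sylvesterK => //.
by rewrite anticomm_linear !sylvesterP.
Qed.

Lemma sylvester_bound P : spd P ->
  exists2 c, 0 < c & forall Z, `|sylvester P Z| <= c * `|Z|.
Proof.
move=> Pspd; have [Q [d [Qo PE d0]]] := spd_spectral Pspd.
have wC (i j : 'I_n) : (d 0 i + d 0 j)^-1 = (d 0 j + d 0 i)^-1 by rewrite addrC.
have [c c0 h] := schur_sym_bound wC Qo; exists c => // Z.
suff -> : sylvester P Z = schur_sym Q wC Z by exact: h.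
by apply: sym_inj; rewrite (sylvesterE Z Pspd Qo PE).
Qed.

(** Subtracting the equations at x and at P shows that V x - V P solves the equation
    at P with right-hand side Z x - Z P minus the anticommutator of x - P and V x;
    for x close to P the part of V x in the last term is absorbed on the left. *)
Lemma sylvester_perturb P : spd P -> exists2 c, 0 < c &
  forall (V Z : sym R n -> sym R n), (\forall x \near P, anticomm x (V x) = Z x) ->
  \forall x \near P, `|V x - V P| <= c * (`|Z x - Z P| + `|x - P| * `|V P|).
Proof.
move=> Pspd; have [c c0 hc] := sylvester_bound Pspd.
pose k : R := 2 * n%:R + 1.
have k0 : 0 < k by rewrite ltr_pwDr // mulr_ge0.
have k1 : 1 <= k by rewrite lerDr mulr_ge0.
exists (2 * c * k) => [|V Z VZ]; first by rewrite !mulr_gt0.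
(* radius on which the absorbed term is at most half of the left-hand side *)
have ck0 : 0 < (2 * (c * k))^-1 by rewrite invr_gt0 !mulr_gt0.
near=> x.
have VP := nbhs_singleton VZ.
have Vx : anticomm x (V x) = Z x by near: x.
have E : V x - V P = sylvester P (Z x - Z P - anticomm (x - P) (V x)).
  apply: sylvesterK => //; rewrite anticommBr anticommBl Vx VP.
  by rewrite opprB [RHS]addrC addrA subrK.
set D := `|V x - V P|.
have D0 : 0 <= D by exact: normr_ge0.
have VxD : `|V x| <= D + `|V P|.
  by have := ler_normD (V x - V P) (V P); rewrite subrK.
have xP : `|x - P| <= (2 * (c * k))^-1.
  near: x; apply/nbhs_normP; exists ((2 * (c * k))^-1) => // y /=.
  by rewrite distrC => /ltW.
have le1 : D <= c * (`|Z x - Z P| + k * (`|x - P| * (D + `|V P|))).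
  rewrite {1}/D E; apply: le_trans (hc _) _; rewrite ler_pM2l //.
  apply: le_trans (ler_normB _ _) _; rewrite lerD2l.
  apply: le_trans (anticomm_norm _ _) _; apply: ler_pM.
  - by rewrite mulr_ge0.
  - by rewrite mulr_ge0.
  - by rewrite /k lerDl.
  - by rewrite ler_wpM2l.
have le2 : c * (k * (`|x - P| * D)) <= D / 2.
  have := ler_wpM2l (ltW (mulr_gt0 c0 k0)) xP.
  have -> : c * k * (2 * (c * k))^-1 = 2^-1 by field; rewrite !gt_eqF.
  by move=> /(ler_wpM2r D0); lra.
have z0 := normr_ge0 (Z x - Z P).
have : c * `|Z x - Z P| <= c * (k * `|Z x - Z P|).
  by rewrite ler_wpM2l ?(ltW c0) // ler_peMl.
by move: le1 le2; lra.
Unshelve. all: by end_near. Qed.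

Lemma sylvester_cont P (V Z : sym R n -> sym R n) : spd P ->
  (\forall x \near P, anticomm x (V x) = Z x) ->
  {for P, continuous Z} -> {for P, continuous V}.
Proof.
move=> Pspd VZ cZ; have [c c0 hc] := sylvester_perturb Pspd.
have {hc}h := hc V Z VZ; move/continuous_normP: cZ => cZ.
apply/continuous_normP => e e0; pose k := 2 * (c * (`|V P| + 1)).
have k0 : 0 < k by rewrite !mulr_gt0 // ltr_pwDr.
have ec : 0 < e / (2 * c) by rewrite divr_gt0 // mulr_gt0.
have ek : 0 < e / k by rewrite divr_gt0.
near=> x; rewrite distrC.
apply: le_trans (_ : c * (`|Z x - Z P| + `|x - P| * `|V P|) <= e).
  by near: x.
have Zx : `|Z x - Z P| <= e / (2 * c) by rewrite distrC; near: x; exact: cZ.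
have xP : `|x - P| <= e / k.
  near: x; apply/nbhs_normP; exists (e / k) => // y /=.
  by rewrite distrC => /ltW.
have h1 : c * `|Z x - Z P| <= e / 2.
  have -> : e / 2 = c * (e / (2 * c)) by field; rewrite gt_eqF.
  by rewrite ler_pM2l.
have h2 : c * (`|x - P| * `|V P|) <= e / 2.
  apply: (@le_trans _ _ (c * (e / k * (`|V P| + 1)))).
    by rewrite ler_pM2l // ler_pM // lerDl.
  have -> : c * (e / k * (`|V P| + 1)) = e / 2; last by [].
  by rewrite /k; field; rewrite !gt_eqF // ltr_pwDr.
by rewrite mulrDr; lra.
Unshelve. all: by end_near. Qed.

(** Product rule applied to anticomm x (V x) = Z x; the remainder of V solves the
    equation at P with right-hand side of order o(h). *)
Lemma sylvester_diff P (V Z : sym R n -> sym R n) : spd P ->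
  (\forall x \near P, anticomm x (V x) = Z x) -> differentiable Z P ->
  differentiable V P /\
  forall h, anticomm P ('d V P h) = 'd Z P h - anticomm h (V P).
Proof.
move=> Pspd VZ dZ.
have cV : {for P, continuous V}.
  by apply: sylvester_cont VZ _ => //; exact: differentiable_continuous.
have [c c0 hc] := sylvester_bound Pspd.
pose L h := sylvester P ('d Z P h - anticomm h (V P)).
have Llin : linear L.
  move=> a X Y; rewrite /L -(sylvester_linear Pspd); congr sylvester.
  rewrite linearP scalerBr !(anticommC _ (V P)) anticomm_linear opprD.
  by rewrite addrACA.
pose LlM := GRing.isLinear.Build _ _ _ _ _ Llin.
pose LL : {linear sym R n -> sym R n} := HB.pack L LlM.
have [k k0 Zk] := linear_lipschitz (diff_continuous dZ).
have cLL : continuous LL.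
  apply: bounded_linear_continuous; apply/linear_boundedP.
  near=> M => X; apply: (@le_trans _ _ (c * (k + 2 * n%:R * `|V P|) * `|X|)).
    apply: le_trans (hc _) _; rewrite -mulrA ler_pM2l //.
    apply: le_trans (ler_normB _ _) _; rewrite mulrDl lerD //.
    by apply: le_trans (anticomm_norm _ _) _; rewrite -!mulrA [`|X| * _]mulrC.
  by apply: ler_wpM2r => //; near: M; exact: nbhs_pinfty_ge.
suff h e : 0 < e -> \forall h \near (0 : sym R n),
    `|V (h + P) - V P - LL h| <= e * `|h|.
  have [dV VE] := diff_of_bound cLL h; split=> // y.
  have e : 'd V P y = L y := congr1 (@^~ y) VE.
  exact: etrans (congr1 (anticomm P) e) (sylvesterP _ Pspd).
move=> e0; pose k1 := c * (2 * n%:R + 1).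
have k10 : 0 < k1 by rewrite mulr_gt0 // ltr_pwDr // mulr_ge0.
have ec : 0 < e / (2 * c) by rewrite divr_gt0 // mulr_gt0.
have ek : 0 < e / (2 * k1) by rewrite divr_gt0 // mulr_gt0.
have VZ' := near0_shift VZ.
move/continuous_normP: cV => cV.
have hZ := diff_bound dZ ec; have hV := near0_shift (cV _ ek).
near=> h.
have Vh : anticomm (h + P) (V (h + P)) = Z (h + P) by near: h.
have VP := nbhs_singleton VZ.
have Zh : `|Z (h + P) - Z P - 'd Z P h| <= e / (2 * c) * `|h| by near: h.
have {}Vc : `|V P - V (h + P)| <= e / (2 * k1) by near: h.
set D := V (h + P) - V P.
have -> : D - LL h = sylvester P (Z (h + P) - Z P - 'd Z P h - anticomm h D).
  (* the equation at h + P, seen from P *)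
  have PV : anticomm P (V (h + P)) = Z (h + P) - anticomm h (V (h + P)).
    by rewrite -Vh [in RHS]anticommC anticommDr addrAC !(anticommC (V _)) subrr add0r.
  have rearrange (a b s t u : sym R n) : a - t - b - (s - u) = a - b - s - (t - u).
    rewrite !opprB (addrAC a) -!addrA; congr (_ + (_ + _)).
    by rewrite [LHS]addrCA [RHS]addrCA; congr (_ + _); exact: addrC.
  apply: sylvesterK => //; rewrite anticommBr [LL h]/(L h) sylvesterP //.
  by rewrite /D !anticommBr PV VP rearrange.
apply: le_trans (hc _) _.
have Dn : `|anticomm h D| <= 2 * n%:R * (`|h| * (e / (2 * k1))).
  apply: le_trans (anticomm_norm _ _) _; rewrite ler_wpM2l ?mulr_ge0 //.
  by rewrite ler_wpM2l // /D distrC.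
apply: (@le_trans _ _ (c * (e / (2 * c) * `|h| +
    (2 * n%:R + 1) * (`|h| * (e / (2 * k1)))))).
  rewrite ler_pM2l //; apply: le_trans (ler_normB _ _) _; rewrite lerD //.
  by apply: le_trans Dn _; rewrite ler_wpM2r ?lerDl // mulr_ge0 // ltW.
rewrite le_eqVlt; apply/orP; left; apply/eqP; rewrite /k1; field.
by rewrite !gt_eqF // ltr_pwDr // mulr_ge0.
Unshelve. all: by end_near. Qed.

(** The derivative of the solution solves a Sylvester equation with continuous
    right-hand side (sylvester_diff), hence is continuous (sylvester_cont). *)
Lemma C1_on_sylvester (Z : sym R n -> sym R n) :
  C1_on (@spd R n) Z -> C1_on (@spd R n) (fun x => sylvester x (Z x)).
Proof.
move=> ZC; set V := fun x => sylvester x (Z x).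
have VZ x : spd x -> \forall y \near x, anticomm y (V y) = Z y.
  by move=> /spd_near; apply: filterS => y ys; exact: sylvesterP.
have dV x : spd x -> differentiable V x /\
    forall h, anticomm x ('d V x h) = 'd Z x h - anticomm h (V x).
  by move=> xs; apply: sylvester_diff (VZ x xs) _ => //; have [] := ZC x xs.
move=> P Ps; have [dVP _] := dV P Ps; split=> // v.
apply: (@sylvester_cont P _ (fun x => 'd Z x v - anticomm v (V x))) => //.
  by apply: filterS (spd_near Ps) => x xs; have [_ ->] := dV x xs.
have [_ cZ] := ZC P Ps.
have cZv : 'd Z x v @[x --> P] --> 'd Z P v := cZ v.
have cV : V x @[x --> P] --> V P := differentiable_continuous dVP.
have cv : v @[_ --> P] --> v := @cst_continuous _ _ v P.
exact: cvgB cZv (anticomm_cvg cv cV).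
Qed.

End SylvesterSolution.

(** * The Procrustes metric with exponent one *)

Section ProcrustesMetric.
Variables (R : realType) (n : nat).
Implicit Types (P X Y Z H : sym R n) (Q : 'M[R]_n) (d : 'rV[R]_n).

(** The logarithmic means cancel: ln (x^2) - ln (y^2) is twice ln x - ln y. *)
Lemma divided_difference_exp_ln (x y : R) : 0 < x -> 0 < y ->
  divided_difference expR expR (ln x) (ln y) *
  divided_difference (@ln R) GRing.inv (x ^+ 2) (y ^+ 2) = 2 / (x + y).
Proof.
move=> x0 y0; rewrite /divided_difference.
have [->|yx] := eqVneq y x.
  rewrite !eqxx lnK ?posrE //; field.
  by rewrite !gt_eqF // addr_gt0.
have lnyx : ln y - ln x != 0.
  by rewrite subr_eq0; apply: contra yx => /eqP/ln_inj -> //; rewrite posrE.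
have y2x2 : y ^+ 2 - x ^+ 2 != 0.
  by rewrite subr_eq0 eqrXn2 // ltW.
have yx0 : y - x != 0 by rewrite subr_eq0.
rewrite -(subr_eq0 (ln y)) -(subr_eq0 (y ^+ 2)) (negbTE lnyx) (negbTE y2x2).
rewrite !lnK ?posrE //.
rewrite !lnXn //; rewrite subr_sqr in y2x2 *; field.
by rewrite lnyx yx0 /= addrC gt_eqF // addr_gt0.
Qed.

Section AtPoint.
Variables (P : sym R n) (Q : 'M[R]_n) (d : 'rV[R]_n).
Hypotheses (Qo : orthogonal_mx Q) (PE : (P : 'M[R]_n) = Q *m diag_mx d *m Q^T).
Hypothesis d0 : forall i, 0 < d 0 i.

Let sq i : R := d 0 i ^+ 2.

(** The factor by which the metric at P scales the (i, j) entry in an eigenbasis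
    of P.  Its values lie in [1/2, 1] whatever the eigenvalues, which is where
    independence of the condition number of P comes from. *)
Definition metric_weight (i j : 'I_n) : R :=
  (d 0 i + d 0 j) ^+ 2 / (2 * (sq i + sq j)).

Let sq_gt0 i : 0 < sq i. Proof. by rewrite exprn_gt0. Qed.
Let sum_gt0 i j : 0 < d 0 i + d 0 j. Proof. by rewrite addr_gt0. Qed.
Let sqsum_gt0 i j : 0 < sq i + sq j. Proof. by rewrite addr_gt0. Qed.

Lemma metric_weightC i j : metric_weight i j = metric_weight j i.
Proof. by rewrite /metric_weight [d 0 i + _]addrC [sq i + _]addrC. Qed.

Lemma metric_weight_gt0 i j : 0 < metric_weight i j.
Proof. by rewrite divr_gt0 ?exprn_gt0 ?mulr_gt0. Qed.

(** The bounds are 2 di dj <= di^2 + dj^2 and 0 <= 2 di dj. *)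
Lemma metric_weight_inv_bounds i j : 1 <= (metric_weight i j)^-1 <= 2.
Proof.
have s0 := exprn_gt0 2 (sum_gt0 i j).
rewrite /metric_weight invfM invrK mulrC ler_pdivlMr // ler_pdivrMr //.
have di := d0 i; have dj := d0 j; have dij := sqr_ge0 (d 0 i - d 0 j).
by apply/andP; split; rewrite /sq; nra.
Qed.

Lemma sym_pow2E : mx_of_sym (sym_pow (2 * 1) P) =
  Q *m diag_mx (\row_i sq i) *m Q^T.
Proof.
rewrite (spectral_funE _ Qo PE); congr (_ *m diag_mx _ *m _).
by apply/rowP => i; rewrite !mxE mulr1 powR_mulrn // ltW.
Qed.

Lemma diff_exp_log_schur X :
  ('d (@sym_exp R n) (sym_log P) ('d (@sym_log R n) (sym_pow (2 * 1) P) X) : 'M[R]_n) =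
  schur_op Q (fun i j => 2 / (d 0 i + d 0 j)) X.
Proof.
have logE := spectral_funE (@ln R) Qo PE.
have lnd i : is_derive ((\row_i sq i) 0 i) 1 (@ln R) (((\row_i sq i) 0 i)^-1).
  by apply: is_derive1_ln; rewrite mxE.
have expd i : is_derive (map_mx (@ln R) d 0 i) 1 expR (expR (map_mx (@ln R) d 0 i)).
  exact: is_derive_expR.
rewrite (spectral_fun_diff Qo logE expd).
rewrite (spectral_fun_diff (dphi := GRing.inv) Qo sym_pow2E lnd) schur_op_comp //.
by apply: eq_schur_op => i j; rewrite !mxE divided_difference_exp_ln.
Qed.

Let opw (i j : 'I_n) : R := (d 0 i + d 0 j) / (2 * (sq i + sq j)).

Lemma opwC i j : opw i j = opw j i.
Proof. by rewrite /opw [d 0 i + _]addrC [sq i + _]addrC. Qed.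

Lemma procrustes_equation H :
  ('d (@sym_exp R n) (sym_log P) ('d (@sym_log R n) (sym_pow (2 * 1) P)
      (anticomm H (sym_pow (2 * 1) P))) : 'M[R]_n) =
  schur_op Q (fun i j => (opw i j)^-1) H.
Proof.
rewrite diff_exp_log_schur anticommC (anticommE _ Qo sym_pow2E) schur_op_comp //.
apply: eq_schur_op => i j; rewrite !mxE /opw; field.
by rewrite !gt_eqF.
Qed.

Lemma procrustes_opE Y :
  (procrustes_op 1 P Y : 'M[R]_n) = schur_op Q opw Y.
Proof.
have opwK i j : opw i j * (opw i j)^-1 = 1.
  by rewrite mulfV // gt_eqF // divr_gt0 // mulr_gt0.
have sol : 'd (@sym_exp R n) (sym_log P) ('d (@sym_log R n) (sym_pow (2 * 1) P)
      (anticomm (procrustes_op 1 P Y) (sym_pow (2 * 1) P))) = Y.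
  apply: (@getPex _ [set H | 'd (@sym_exp R n) (sym_log P)
    ('d (@sym_log R n) (sym_pow (2 * 1) P) (anticomm H (sym_pow (2 * 1) P))) = Y]).
  exists (schur_sym Q opwC Y); apply: sym_inj; rewrite procrustes_equation /=.
  by rewrite schur_op_comp // schur_op1 // => i j; rewrite mulrC opwK.
apply: schur_opK Qo opwK _.
by rewrite -procrustes_equation sol.
Qed.

(** 4 tr(A S B) is twice the Frobenius product of A with the anticommutator of B and
    S, so that all factors become Schur multipliers. *)
Lemma procrustes_metricE X Y : procrustes_metric 1 P X Y =
  \tr ((X : 'M[R]_n)^T *m schur_op Q metric_weight Y).
Proof.
rewrite /procrustes_metric; set S : 'M[R]_n := sym_pow (2 * 1) P.
set A := procrustes_op 1 P X; set B := procrustes_op 1 P Y.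
have -> : 4 * \tr ((A : 'M[R]_n) *m S *m B) =
    2 * \tr ((A : 'M[R]_n)^T *m (B *m S + S *m B)).
  (* transpose and rotate the trace *)
  have swap : \tr ((A : 'M[R]_n) *m B *m S) = \tr ((A : 'M[R]_n) *m S *m B).
    rewrite -mxtrace_tr !trmx_mul (sym_tr A) (sym_tr B) [S^T](sym_tr _).
    by rewrite mulmxA mxtrace_mulC mulmxA.
  by rewrite sym_tr mulmxDr linearD /= !mulmxA swap; ring.
rewrite [S]sym_pow2E anticomm_schur // /A /B !procrustes_opE schur_op_selfadjoint.
rewrite !schur_op_comp // -linearZ /= scalemxAr -schur_op_scale.
congr (\tr (_ *m _)); apply: eq_schur_op => i j.
rewrite !mxE /opw /metric_weight; field.
by rewrite gt_eqF.
Qed.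

End AtPoint.
End ProcrustesMetric.

(** * Riemannian gradient and Hessian at a critical point *)

Section RiemannianGradient.
Variables (R : realType) (n : nat) (f : sym R n -> R^o).
Implicit Types x X Y Z : sym R n.

(** Its weight in an eigenbasis is (di + dj)^-1 (2 di^2 + 2 dj^2) (di + dj)^-1, the
    inverse of metric_weight.  Only anticommutators and solutions of Sylvester
    equations occur, so the field is C1 by the closure lemmas. *)
Definition rgrad_formula (x : sym R n) : sym R n :=
  sylvester x (anticomm (anticomm x x) (sylvester x (egrad f x))).

Lemma rgrad_formulaE (x : sym R n) (Q : 'M[R]_n) (d : 'rV[R]_n) : orthogonal_mx Q ->
  (x : 'M[R]_n) = Q *m diag_mx d *m Q^T -> (forall i, 0 < d 0 i) ->
  (rgrad_formula x : 'M[R]_n) =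
    schur_op Q (fun i j => (metric_weight d i j)^-1) (egrad f x).
Proof.
move=> Qo xE d0; have xs : spd x by apply/(spd_eigenvalues Qo xE).
have xxE : (anticomm x x : 'M[R]_n) = Q *m diag_mx (\row_i (2 * d 0 i ^+ 2)) *m Q^T.
  rewrite /= xE -[RHS]mulmxA !mulmxA -!(mulmxA _ Q^T Q) Qo !mulmx1 -mulr2n.
  rewrite -(mulmxA Q) mulmx_diag -!mulmxA -scaler_nat scalemxAr scalemxAl.
  congr (_ *m (_ *m _)); apply/matrixP => i j.
  by rewrite !mxE expr2 mulrnAr.
rewrite /rgrad_formula (sylvesterE _ xs Qo xE) (anticommE _ Qo xxE).
rewrite (sylvesterE _ xs Qo xE) !schur_op_comp //; apply: eq_schur_op => i j.
rewrite /metric_weight !mxE; field.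
by rewrite !gt_eqF ?addr_gt0 ?exprn_gt0.
Qed.

Lemma procrustes_metric_rgrad_formula x Y : spd x ->
  procrustes_metric 1 x (rgrad_formula x) Y = 'd f x Y.
Proof.
move=> /spd_spectral[Q [d [Qo xE d0]]].
rewrite (procrustes_metricE Qo xE d0) (rgrad_formulaE Qo xE d0).
rewrite schur_op_selfadjoint schur_op_comp // schur_op1 // => [|i j].
  exact: frob_egrad.
by rewrite mulVf // gt_eqF // metric_weight_gt0.
Qed.

Lemma procrustes_metric_inj x X Y : spd x ->
  (forall Z, procrustes_metric 1 x X Z = procrustes_metric 1 x Y Z) -> X = Y.
Proof.
move=> /spd_spectral[Q [d [Qo xE d0]]] h; apply: frob_inj => Z.
have wC i j : (metric_weight d i j)^-1 = (metric_weight d j i)^-1.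
  by rewrite metric_weightC.
have := h (schur_sym Q wC Z); rewrite !(procrustes_metricE Qo xE d0) /=.
rewrite schur_op_comp // schur_op1 // => i j.
by rewrite mulfV // gt_eqF // metric_weight_gt0.
Qed.

Lemma rgradE x : spd x -> rgrad 1 f x = rgrad_formula x.
Proof.
move=> xs; apply: procrustes_metric_inj (xs) _ => Z.
rewrite procrustes_metric_rgrad_formula //.
apply: (@getPex _ [set G | forall Y, procrustes_metric 1 x G Y = 'd f x Y]).
by exists (rgrad_formula x) => Y; exact: procrustes_metric_rgrad_formula.
Qed.

Lemma procrustes_metric_rgrad x Y : spd x ->
  procrustes_metric 1 x (rgrad 1 f x) Y = 'd f x Y.
Proof. by move=> xs; rewrite rgradE // procrustes_metric_rgrad_formula. Qed.

Lemma rgrad_C1 : C2_on (@spd R n) f -> C1_on (@spd R n) (rgrad 1 f).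
Proof.
move=> fC; have o := @spd_open R n.
apply: (C1_on_eq o rgradE).
apply: C1_on_sylvester; apply: C1_on_anticomm => //.
  exact: C1_on_anticomm o (C1_on_id o) (C1_on_id o).
by apply: C1_on_sylvester; exact: egrad_C1.
Qed.

End RiemannianGradient.

Section HessianMatrices.
Variables (R : realType) (n : nat) (f : sym R n -> R^o) (P : sym R n).
Hypotheses (fC2 : C2_on (@spd R n) f) (Ps : spd P).
Hypothesis Pmin : nondegenerate_local_min f P.

Lemma near_differentiable : \forall x \near P, differentiable f x.
Proof.
by have [fd _] := fC2; apply: filterS (spd_near Ps) => x xs; exact: fd.
Qed.

Lemma critical_point Y : 'd f P Y = 0.
Proof.
have [fd _] := fC2; have [fmin _] := Pmin.
apply: local_min_diff0 near_differentiable _ _; first exact: fd.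
by apply: filterS2 fmin (spd_near Ps) => x h xs; exact: h.
Qed.

Lemma ehess_sym X Y : frob (ehess f P X) Y = frob (ehess f P Y) X.
Proof.
have o := @spd_open R n.
rewrite !(frob_ehess _ _ o fC2 Ps).
have [_ fC] := fC2.
apply: second_diff_symmetric near_differentiable _ _.
  by have [] := fC Y P Ps.
by have [] := fC X P Ps.
Qed.

(** Metric compatibility along X for the gradient field and the constant field Y:
    the left side differentiates g(grad f, Y) = df(Y), and the term with the
    derivative of Y contains grad f, which vanishes at P.  Neither the connection
    nor the derivative of the metric has to be computed. *)
Lemma rhess_ehess nabla X Y :
  levi_civita (@spd R n) (@procrustes_metric R n 1) nabla ->
  procrustes_metric 1 P (rhess 1 nabla f P X) Y = frob (ehess f P X) Y.
Proof.
move=> [_ _ compat]; have o := @spd_open R n.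
have := compat P X (rgrad 1 f) (fun=> Y) Ps (rgrad_C1 fC2) (C1_on_cst Y o).
rewrite (frob_ehess _ _ o fC2 Ps) -/(rhess 1 nabla f P X).
rewrite [X in _ = _ + X]procrustes_metric_rgrad // critical_point addr0 => <-.
have [_ fC] := fC2; have [dY _] := fC Y P Ps.
(* only the germ at P matters for the derivative *)
have near_eq : \forall x \near P,
    (procrustes_metric 1 x (rgrad 1 f x) Y : R^o) = 'd f x Y.
  by apply: filterS (spd_near Ps) => x xs; exact: procrustes_metric_rgrad.
have [_ e] := near_eq_diff near_eq dY.
exact: (congr1 (@^~ X) e).
Qed.

Variables (Q : 'M[R]_n) (d : 'rV[R]_n).
Hypotheses (Qo : orthogonal_mx Q) (PE : (P : 'M[R]_n) = Q *m diag_mx d *m Q^T).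

Let HE := matrix_in_basis (eigen_basis Q) (ehess f P).

Lemma euclidean_hessian_sym : HE^T = HE.
Proof.
apply/matrixP => a b; rewrite mxE !matrix_in_basisE // frobC ehess_sym.
exact: frobC.
Qed.

Lemma euclidean_hessian_pos x : x != 0 -> 0 < qform HE x.
Proof.
move=> x0; pose Y := \sum_k x 0 k *: eigen_basis Q k.
have xE k : frob (eigen_basis Q k) Y = x 0 k.
  rewrite frob_sumr (bigD1 k) //= big1 => [|l lk].
    by rewrite frobZr eigen_basis_orthonormal // eqxx mulr1 addr0.
  by rewrite frobZr eigen_basis_orthonormal // eq_sym (negbTE lk) mulr0.
have Y0 : Y != 0.
  apply: contra x0 => /eqP Y0; apply/eqP/rowP => k.
  by rewrite -xE Y0 frobC frob0l mxE.
suff -> : qform HE x = frob Y (ehess f P Y) by have [_ h] := Pmin; exact: h.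
rewrite /qform dotE {1}/Y frob_suml.
apply: eq_bigr => k _; rewrite frobZl mulrC; congr (_ * _).
rewrite /ehess /Y linear_sum frob_sumr mxE; apply: eq_bigr => l _.
rewrite linearZ frobZr; congr (_ * _).
by rewrite /HE matrix_in_basisE // frobC -ehess_sym frobC.
Qed.

(** In the eigenbasis, rhess_ehess says that each row of the Riemannian matrix
    times its metric weight is the corresponding row of the Euclidean one. *)
Lemma riemannian_hessian_scaling nabla :
  levi_civita (@spd R n) (@procrustes_metric R n 1) nabla ->
  exists2 w : 'rV[R]_(#|{: pair_idx n}|), (forall k, 1 <= w 0 k <= 2) &
    matrix_in_basis (eigen_basis Q) (rhess 1 nabla f P) = diag_mx w *m HE.
Proof.
move=> lc; have d0 := (proj1 (spd_eigenvalues Qo PE) Ps).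
pose w k := metric_weight d (pair_of k).1 (pair_of k).2.
exists (\row_k (w k)^-1) => [k|]; first by rewrite mxE; exact: metric_weight_inv_bounds.
apply/matrixP => a b; rewrite mul_diag_mx !mxE !matrix_in_basisE //.
rewrite [in RHS]frobC -(rhess_ehess _ _ lc) (procrustes_metricE Qo PE d0).
rewrite schur_op_eigen_basis // => [|i j]; last exact: metric_weightC.
rewrite -/(w a) -scalemxAr linearZ /= mulrA mulVf ?mul1r; first exact: frobC.
by rewrite gt_eqF // metric_weight_gt0.
Qed.

End HessianMatrices.

Lemma card_pair_idx_gt0 n : (0 < n)%N -> (0 < #|{: pair_idx n}|)%N.
Proof.
case: n => // n _; apply/card_gt0P.
by exists (Sub (ord0, ord0) (leqnn 0) : pair_idx n.+1).
Qed.

Theorem theorem6 (R : realType) :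
  exists C : R,
  forall (n : nat) (f : sym R n -> R^o) (P : sym R n)
    (Q : 'M[R]_n) (d : 'rV[R]_n)
    (nabla : sym R n -> sym R n -> (sym R n -> sym R n) -> sym R n),
  (0 < n)%N ->
  C2_on (@spd R n) f ->
  spd P ->
  nondegenerate_local_min f P ->
  orthogonal_mx Q ->
  mx_of_sym P = Q *m diag_mx d *m Q^T ->
  levi_civita (@spd R n) (@procrustes_metric R n 1) nabla ->
  let HE := matrix_in_basis (eigen_basis Q) (ehess f P) in
  let H1 := matrix_in_basis (eigen_basis Q) (rhess 1 nabla f P) in
  (lambda_min HE <= lambda_min H1 /\ lambda_max H1 <= 2 * lambda_max HE) /\
  (lambda_max HE <= lambda_max H1 /\ lambda_min H1 <= 2 * lambda_min HE) /\
  (2^-1 * kappa HE <= kappa H1 /\ kappa H1 <= 2 * kappa HE) /\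
  kappa H1 / kappa HE <= C.
Proof.
exists 2 => n f P Q d nabla n0 fC2 Ps Pmin Qo PE lc HE H1.
have N0 := card_pair_idx_gt0 n0.
have HEs := euclidean_hessian_sym fC2 Ps Qo : HE^T = HE.
have HEpos := euclidean_hessian_pos fC2 Ps Pmin Qo.
have [w w12 H1E] := riemannian_hessian_scaling fC2 Ps Pmin Qo PE lc.
rewrite /H1 H1E -/HE.
have [_ ? ? ? ?] := diagonal_scaling_extreme_eigenvalues N0 HEs HEpos w12.
by have [? ? ?] := diagonal_scaling_kappa N0 HEs HEpos w12.
Qed.
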